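(* Consider the $GI/GI/2$ FCFS queue with mean interarrival time $a$, mean service time $b$ and service time distribution $B$. Assume $b\in[a,2a)$ and let both $B$ and the integrated tail distribution $B_I$ be subexponential. Then the stationary waiting time $W$ satisfies, as $x\to\infty$, $$\mathbf{P}\{W\ge x\}\le\frac{1+o(1)}{2a-b}\,\overline{B}_I(2x).$$
   Context: Queue: the $GI/GI/2$ first-come-first-served queue has two identical servers, i.i.d. interarrival times $\{\tau_n\}$ (nonnegative) with finite mean $a=\mathbf{E}\tau_1>0$, and i.i.d. service times $\{\sigma_n\}$ (nonnegative) with finite mean $b=\mathbf{E}\sigma_1>0$; the two sequences are mutually independent. For $w\in\mathbf{R}^2$ let $R(w)$ be the vector with the coordinates of $w$ arranged in ascending order, and $w^+=(\max(0,w_1),\max(0,w_2))$. The residual work vectors $W_n=(W_{n1},W_{n2})$ are defined by $W_1=(0,0)$, $W_{n+1}=R\bigl(W_n+(1,0)\sigma_n-(1,1)\tau_{n+1}\bigr)^+$. The stationary waiting time $W$ is a random variable distributed as the weak limit of $W_{n1}$ as $n\to\infty$ (the system is stable when $b<2a$). Notation: $B$ is the distribution of $\sigma_1$, $\overline{B}(x)=\mathbf{P}\{\sigma_1>x\}$. The integrated tail distribution $B_I$ is the distribution with tail $\overline{B}_I(x)=\min\bigl(1,\int_x^\infty\overline{B}(y)\,dy\bigr)$, $x>0$. A distribution $G$ on $\mathbf{R}^+$ is subexponential if $\overline{G*G}(x)\sim 2\overline{G}(x)$ as $x\to\infty$. *)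

(* Defs.v *)
From HB Require Import structures.
From mathcomp Require Import all_boot all_order all_algebra finmap.
From mathcomp Require Import all_classical all_reals all_analysis.

Set Implicit Arguments.
Unset Strict Implicit.
Unset Printing Implicit Defensive.

Import Order.TTheory GRing.Theory Num.Theory.
Import numFieldNormedType.Exports.

Local Open Scope classical_set_scope.
Local Open Scope ring_scope.

Section Independence.
Context d (T : measurableType d) (R : realType) (P : probability T R).

Definition mutually_independent (X : nat -> {RV P >-> R}) : Prop :=
  forall (J : {fset nat}) (A : nat -> set R), (forall i, measurable (A i)) ->
    P (\bigcap_(i in [set` J]) (X i @^-1` A i))
    = (\prod_(i <- J) P (X i @^-1` A i))%E.

Definition identically_distributed (X : nat -> {RV P >-> R}) : Prop :=
  forall n (A : set R), measurable A ->
    distribution P (X n) A = distribution P (X 0) A.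

Definition iid (X : nat -> {RV P >-> R}) : Prop :=
  mutually_independent X /\ identically_distributed X.

Definition sigma_generated (X : nat -> {RV P >-> R}) : set (set T) :=
  <<s \bigcup_n preimage_set_system setT (X n) measurable >>.

Definition independent_sequences (X Y : nat -> {RV P >-> R}) : Prop :=
  forall E F : set T, sigma_generated X E -> sigma_generated Y F ->
    P (E `&` F) = (P E * P F)%E.

End Independence.

Section WeakConvergence.
Context d (T : measurableType d) d' (T' : measurableType d') (R : realType).

(* The law of [Z] is the weak limit of the laws of the [X n]; [Z] may live on
   another probability space. *)
Definition cvg_in_distribution (P : probability T R) (X : nat -> T -> R)
    (P' : probability T' R) (Z : {RV P' >-> R}) : Prop :=
  forall f : R -> R, continuous f -> (exists M, forall x, `|f x| <= M) ->
    'E_P[f \o X n]%E @[n --> \oo] --> 'E_P'[f \o Z]%E.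

End WeakConvergence.

Section HeavyTails.
Context (R : realType).

Definition tail (G : set R -> \bar R) (x : R) : \bar R := G `]x, +oo[%classic.

Definition convolution (G H : probability R R) : set R -> \bar R :=
  pushforward (G \x H)%E (fun p : R * R => p.1 + p.2).

(* The quotient is a real division, with value 0 when the denominator is 0:
   the convergence to 2 thus forces every tail of [G] to be positive. *)
Definition subexponential (G : probability R R) : Prop :=
  G `]-oo, 0[%classic = 0%E /\
  fine (tail (convolution G G) x) / fine (tail G x) @[x --> +oo] --> (2 : R).

(* [BI] is determined by these values: its possible atom at 0 has mass
   [max 0 (1 - b)], where [b] is the mean of [B]. *)
Definition is_integrated_tail (B BI : probability R R) : Prop :=
  BI `]-oo, 0[%classic = 0%E /\
  forall x : R, 0 < x ->
    tail BI x =
    mine 1%E (\int[lebesgue_measure]_(y in `]x, +oo[) tail B y)%E.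

End HeavyTails.

Section Queue.
Context (R : realType).

Definition ascending (w : R * R) : R * R :=
  (Num.min w.1 w.2, Num.max w.1 w.2).

Definition pos_part (w : R * R) : R * R := (Num.max 0 w.1, Num.max 0 w.2).

(* Indices start at 0: [sigma n], [tau n] and [residual_work tau sigma n] stand
   for sigma_(n+1), tau_(n+1) and W_(n+1).  In particular [tau 0] is unused. *)
Fixpoint residual_work (T : Type) (tau sigma : nat -> T -> R) (n : nat)
    (t : T) : R * R :=
  if n is m.+1 then
    let w := residual_work tau sigma m t in
    pos_part (ascending (w.1 + sigma m t - tau m.+1 t, w.2 - tau m.+1 t))
  else (0, 0).

End Queue.

(* Main.v *)
Require Import Defs.
From HB Require Import structures.
From mathcomp Require Import all_boot all_order all_algebra finmap.
From mathcomp Require Import all_classical all_reals all_analysis.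
From mathcomp Require Import measurable_realfun.
From mathcomp Require Import ring lra zify.

Set Implicit Arguments.
Unset Strict Implicit.
Unset Printing Implicit Defensive.

Import Order.TTheory GRing.Theory Num.Theory.
Import numFieldNormedType.Exports.

Local Open Scope classical_set_scope.
Local Open Scope ring_scope.

(** Heuristically, the waiting time behaves like that of one server whose
    service times are halved, for which the tail is asymptotically
    [tail BI (2 * x) / (2 * a - b)].  The total work [w1 + w2] cannot be compared
    directly with that single queue, because the less loaded server may idle
    while the other one works off a long job.  As [a <= b], the less loaded
    server then sees a queue that is not stable, so it idles during a vanishing
    fraction of the time only.

    This is made quantitative by the function
    [w1 + w2 + (C - w1)^+ ^2 / (2 C)] ([lyapunov]).  As long as [w2] exceeds [C],
    its mean drift is at most [- (2 a - b)] up to a small error, whatever [w1] is: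
    the quadratic term pays for the idle time ([lyapunov_next_drift]); and one
    service time [s] never raises it by more than [s] ([lyapunov_next]).

    Choose a level [K] and a number [u] slightly below [2 a - b].  The service
    times above [K], rounded up to multiples of [u], feed a chain on the natural
    numbers which moves down by one unit per customer ([jumps]).  What is left,
    the bounded increments augmented by [u], still has negative mean, hence is
    controlled by an exponential moment ([weight]).  Pathwise,
    [exp (th * (lyapunov - const - u * jumps))] is at most [weight]
    ([weight_dominates]).

    Since [jumps] is skip-free downwards, its stationary tail [r] solves exactly
    a defective renewal equation [r = H + q * r] ([renewal_solution]).  An
    induction on the number of customers, which uses only that the next service
    time and the next interarrival time are independent of the past, bounds both
    [P (j <= jumps)] by [r j] and [E (weight; j <= jumps)] by a multiple of [r j]
    ([jumps_tail_le], [weight_tail_le]); so the bounded increments contribute no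
    more than an exponentially damped average of [r] ([work_tail_le]).

    The terms [q] and [H] of the renewal equation are bounded by increments and
    values of [x |-> E (sigma - x)^+], which is the integrated tail.  Subexponentiality of
    [BI] gives [r j <= (1 + o(1)) * tail BI (u * j) / (u * (1 - rho))], where
    [rho], the mean of one jump, is small when [K] is large ([renewal_limsup]).
    With [u] close to [2 a - b] and [rho] close to 0 the resulting bound is
    uniform in the number of customers ([uniform_tail_bound]), so it passes to
    the weak limit ([weak_limit_tail_le]). *)

(** * Sequences with long and subexponential tails *)

(* Real hypotheses are cleared before calling lia, which would otherwise
   preprocess all of them. *)
Ltac nat_lia :=
  repeat match goal with H : is_true (leq _ _) |- _ => revert H end;
  clear; intros; lia.

Section RenewalTail.
Context (R : realType).
Implicit Types b q H r : nat -> R.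

Definition long_tailed_seq b :=
  forall l : R, 1 < l -> exists N, forall n, (N <= n)%N -> b n <= l * b n.+1.

Lemma long_tailed_shift b s : (forall n, 0 <= b n) -> long_tailed_seq b ->
  forall l : R, 1 < l ->
    exists N, forall n, (N <= n)%N -> b n <= l * b (n + s)%N.
Proof.
move=> b0 bl; elim: s => [|s IH] l l1.
  exists 0%N => n _; rewrite addn0 ler_peMl//; exact: ltW.
(* One factor for the shift by s and one for the last step: the square of the
   new factor is at most l. *)
pose l' : R := 1 + Num.min 1 (l - 1) / 3.
have m0 : 0 < Num.min 1 (l - 1) by rewrite lt_min ltr01 subr_gt0.
have m1 : Num.min 1 (l - 1) <= 1 by rewrite ge_min lexx.
have m2 : Num.min 1 (l - 1) <= l - 1 by rewrite ge_min lexx orbT.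
have l'1 : 1 < l' by rewrite /l'; lra.
have l'l : l' * l' <= l by rewrite /l'; move: m0 m1 m2; set x := Num.min _ _ => *; nra.
have [N1 h1] := IH _ l'1; have [N2 h2] := bl _ l'1.
exists (maxn N1 N2) => n; rewrite geq_max => /andP[n1 n2].
apply: (le_trans (h1 _ n1)).
have := h2 (n + s)%N (leq_trans n2 (leq_addr _ _)).
rewrite addnS; have := b0 (n + s).+1.
move: (b (n+s)%N) (b (n+s).+1) => x y.
move=> y0 xy; apply: (@le_trans _ _ (l' * (l' * y))).
  by rewrite ler_wpM2l//; lra.
by rewrite mulrA ler_wpM2r.
Qed.

(** Lattice form of subexponentiality: for two independent variables with tail
    [b], the event that their sum exceeds [j] while the first one lies between
    [L] and [j] is negligible with respect to [b j]. *)
Definition subexponential_seq b := forall e : R, 0 < e ->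
  exists L N, forall j, (N <= j)%N ->
    \sum_(L <= i < j) (b i - b i.+1) * b (j - i)%N <= e * b j.

Context b q H r (k rho : R).
Context (b_gt0 : forall n, 0 < b n).
Context (b_dec : forall m n, (m <= n)%N -> b n <= b m).
Context (b_long : long_tailed_seq b).
Context (b_sub : subexponential_seq b).
Context (k_ge0 : 0 <= k).
Context (q_ge0 : forall i, 0 <= q i).
Context (q_sum : forall n, \sum_(0 <= i < n) q i <= rho).
Context (rho_lt1 : rho < 1).
Context (q_le : exists N, forall i, (N <= i)%N -> q i.+2 <= k * (b i - b i.+1)).
Context (H_le : exists N, forall i, (N <= i)%N -> H i.+2 <= k * b i).
Context (r_ge0 : forall i, 0 <= r i).
Context (rE : forall j, (0 < j)%N ->
  r j = H j + \sum_(0 <= i < j) q i * r (j - i)%N).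

(** One use of the renewal equation.  Small [i] contribute at most [rho] times
    the recent ratios [r / b], because [b] is long-tailed; the remaining [i] fall
    under the subexponential estimate and cost only a small multiple of a global
    bound [M] of the ratios. *)
Lemma renewal_step (e : R) : 0 < e -> exists L N, forall j, (N <= j)%N ->
  forall M M' : R, 0 <= M -> 0 <= M' ->
  (forall i, (i <= j)%N -> r i <= M * b i) ->
  (forall i, (j - L <= i <= j)%N -> r i <= M' * b i) ->
  r j <= (k * (1 + e) + rho * (1 + e) * M' + e * M) * b j.
Proof.
move=> e0; have [k0 rho1] := (k_ge0, rho_lt1).
have b0 n : 0 <= b n by exact: ltW.
have rho0 : 0 <= rho by have := q_sum 0; rewrite big_geq.
have e1 : 1 < 1 + e by lra.
have [Nq hq] := q_le; have [NH hH] := H_le.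
(* The factor 1 + e will pay for replacing b (j - 2) by b j. *)
pose e' := e / (1 + e) / (k + 1).
have k1 : 0 < k + 1 by rewrite ltr_wpDl.
have e10 : 0 < 1 + e by lra.
have e'0 : 0 < e' by rewrite /e' divr_gt0// divr_gt0.
have [L0 [N0 h0]] := b_sub e'0.
pose L := maxn L0 Nq.
have [N1 h1] := long_tailed_shift 2 b0 b_long e1.
have [N2 h2] := long_tailed_shift L.+1 b0 b_long e1.
exists L.+1, (N0 + N1 + N2 + NH + L + 3)%N => j jN M M' M0 M'0 rM rM'.
have j0 : (0 < j)%N by nat_lia.
rewrite rE// (@big_cat_nat _ _ _ L.+2)//=; last by nat_lia.
have H1 : H j <= k * (1 + e) * b j.
  have -> : j = (j - 2).+2 by nat_lia.
  rewrite (le_trans (hH _ _))//; first by nat_lia.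
  rewrite -mulrA ler_wpM2l// -(addn2 (j - 2)); apply: h1; nat_lia.
have H2 : \sum_(0 <= i < L.+2) q i * r (j - i)%N <= rho * (1 + e) * M' * b j.
  apply: (@le_trans _ _ (\sum_(0 <= i < L.+2) q i * (M' * ((1 + e) * b j)))).
    rewrite big_nat [leRHS]big_nat ler_sum// => i /andP[_ iL].
    rewrite ler_wpM2l// (le_trans (rM' _ _))//; first by nat_lia.
    rewrite ler_wpM2l// (@le_trans _ _ (b (j - L.+1)%N))//.
      by apply: b_dec; nat_lia.
    have := h2 (j - L.+1)%N; rewrite subnK; last by nat_lia.
    by apply; nat_lia.
  rewrite -big_distrl/=.
  have -> : rho * (1 + e) * M' * b j = rho * (M' * ((1 + e) * b j)) by ring.
  by rewrite ler_wpM2r// !mulr_ge0//; lra.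
have H3 : \sum_(L.+2 <= i < j) q i * r (j - i)%N <= e * M * b j.
  have -> : \sum_(L.+2 <= i < j) q i * r (j - i)%N =
            \sum_(L <= i < j - 2) q i.+2 * r (j - 2 - i)%N.
    rewrite -{1}(addn2 L) big_addn; apply: eq_bigr => i _.
    by rewrite addn2; congr (_ * r _); nat_lia.
  apply: (@le_trans _ _ (\sum_(L <= i < j - 2)
      k * M * ((b i - b i.+1) * b (j - 2 - i)%N))).
    rewrite big_nat [leRHS]big_nat ler_sum// => i /andP[iL ij].
    have hqi := hq i; have {}hqi := hqi (leq_trans (leq_maxr _ _) iL).
    have ri : r (j - 2 - i)%N <= M * b (j - 2 - i)%N by apply: rM; nat_lia.
    rewrite (le_trans (ler_pM _ _ hqi ri))//.
    by rewrite le_eqVlt; apply/orP; left; apply/eqP; ring.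
  rewrite -big_distrr/=.
  have S1 : \sum_(L <= i < j - 2) (b i - b i.+1) * b (j - 2 - i)%N <=
     \sum_(L0 <= i < j - 2) (b i - b i.+1) * b (j - 2 - i)%N.
    rewrite (@big_cat_nat _ _ _ L L0 (j-2))//=; last 2 first.
    - exact: leq_maxl.
    - by nat_lia.
    by rewrite lerDr sumr_ge0// => i _; rewrite mulr_ge0// subr_ge0 b_dec.
  have S2 := h0 (j - 2)%N; have {}S2 := S2 ltac:(nat_lia).
  have S3 := h1 (j - 2)%N; have {}S3 := S3 ltac:(nat_lia).
  rewrite subnK in S3; last by nat_lia.
  apply: (@le_trans _ _ (k * M * (e' * ((1 + e) * b j)))).
    rewrite ler_wpM2l ?mulr_ge0// (le_trans S1)// (le_trans S2)//.
    by rewrite ler_wpM2l// ltW.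
  have -> : k * M * (e' * ((1 + e) * b j)) = (k / (k + 1)) * (e * M * b j).
    by rewrite /e'; field; rewrite !lt0r_neq0//; lra.
  rewrite ler_piMl ?mulr_ge0//; first exact: ltW.
  by rewrite ler_pdivrMr ?mul1r; lra.
rewrite (_ : (_ + _ + _) * b j = k * (1 + e) * b j +
  (rho * (1 + e) * M' * b j + e * M * b j)); last by ring.
by rewrite lerD// lerD.
Qed.

(** A Kesten-type bound: if the ratio [r / b] exceeded [C] for the first time at
    [j], then [renewal_step] with [M = M' = r j / b j] would bound that ratio by a
    fixed number below [C]. *)
Lemma renewal_bounded : exists2 C : R, 0 < C & forall j, r j <= C * b j.
Proof.
have [k0 rho1] := (k_ge0, rho_lt1).
have rho0 : 0 <= rho by have := q_sum 0; rewrite big_geq.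
pose e := (1 - rho) / 4.
have e0 : 0 < e by rewrite /e; lra.
have [L [N h]] := renewal_step e0.
pose th := rho * (1 + e) + e.
have th1 : th < 1 by rewrite /th /e; nra.
(* The sum bounds each of the first N ratios, to which the estimate does not
   apply. *)
pose C0 := \sum_(0 <= i < N) r i / b i.
pose C := C0 + k * (1 + e) / (1 - th) + 1.
have b0 n : 0 <= b n by exact: ltW.
have C00 : 0 <= C0 by rewrite sumr_ge0// => i _; rewrite divr_ge0.
have K0 : 0 <= k * (1 + e) / (1 - th).
  by rewrite divr_ge0// ?mulr_ge0//; lra.
exists C; first by rewrite /C; lra.
elim/ltn_ind => j IH.
have [jN|Nj] := ltnP j N.
  rewrite -ler_pdivrMr//.
  apply: (@le_trans _ _ C0); last by rewrite /C; lra.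
  rewrite /C0 big_mkord (bigD1 (Ordinal jN))//= lerDl sumr_ge0// => i _.
  by rewrite divr_ge0.
rewrite -ler_pdivrMr// leNgt; apply/negP => Cx.
set x := r j / b j in Cx.
have rx : r j = x * b j by rewrite /x divfK// gt_eqF.
have x0 : 0 <= x by rewrite /x divr_ge0.
have hr i : (i <= j)%N -> r i <= x * b i.
  rewrite leq_eqVlt => /orP[/eqP->|ij]; first by rewrite rx.
  by rewrite (le_trans (IH _ ij))// ler_wpM2r// ltW.
have hr2 i : (j - L <= i <= j)%N -> r i <= x * b i.
  by move=> /andP[_ ij]; exact: hr.
have := h _ Nj x x x0 x0 hr hr2.
rewrite rx ler_pM2r// => hx.
have : x <= k * (1 + e) / (1 - th).
  rewrite ler_pdivlMr; last by lra.
  by rewrite /th; nra.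
by rewrite leNgt => /negP; apply; rewrite (le_lt_trans _ Cx)// /C; lra.
Qed.

(** With the global bound at hand, [renewal_step] becomes a contraction of factor
    close to [rho] for the eventual bound of [r / b]; its iterates converge to
    the fixed point [k / (1 - rho)]. *)
Lemma renewal_limsup (k' : R) : k / (1 - rho) < k' ->
  exists N, forall j, (N <= j)%N -> r j <= k' * b j.
Proof.
move=> kk'; have [k0 rho1] := (k_ge0, rho_lt1).
have rho0 : 0 <= rho by have := q_sum 0; rewrite big_geq.
have [C C0 hC] := renewal_bounded.
have k'0 : 0 < k'.
  by rewrite (le_lt_trans _ kk')// divr_ge0//; lra.
have gap : 0 < k' * (1 - rho) - k.
  by rewrite subr_gt0 -ltr_pdivrMr//; lra.
set g := _ - _ in gap.
pose e := g / (2 * (k + C + k' + 1)).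
have e0 : 0 < e by rewrite /e divr_gt0//; lra.
have eE : e * (k + C + k' + 1) = g / 2.
  by rewrite /e; field; rewrite lt0r_neq0//; lra.
have [L [N h]] := renewal_step e0.
pose th := rho * (1 + e); pose K := k * (1 + e) + e * C.
have th0 : 0 <= th by rewrite /th mulr_ge0//; lra.
have Kth : K < k' * (1 - th).
  have ek : 0 <= e * k' by rewrite mulr_ge0// ltW.
  have : e * k' * rho <= e * k' by rewrite ler_piMr// ltW.
  rewrite /K /th; move: eE gap; rewrite /g => eE gap hh.
  nra.
have K0 : 0 <= K.
  have e1 : 0 <= 1 + e by rewrite addr_ge0// ltW.
  have ke : 0 <= k * (1 + e) by exact: mulr_ge0.
  have eC : 0 <= e * C by rewrite mulr_ge0// ltW.
  exact: addr_ge0.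
have th1 : th < 1.
  have : 0 < k' * (1 - th) by exact: le_lt_trans Kth.
  by rewrite pmulr_rgt0//; lra.
have claim n : exists N', forall j, (N' <= j)%N ->
    r j <= (K / (1 - th) + th ^+ n * C) * b j.
  elim: n => [|n [N' IH]].
    exists 0%N => j _; rewrite (le_trans (hC j))// ler_wpM2r//; first exact: ltW.
    by rewrite expr0 mul1r lerDr divr_ge0//; lra.
  exists (N' + N + L)%N => j jN.
  have M'0 : 0 <= K / (1 - th) + th ^+ n * C.
    rewrite addr_ge0//; last by rewrite mulr_ge0// ?exprn_ge0// ltW.
    by rewrite divr_ge0//; lra.
  have := h j _ C _ (ltW C0) M'0 (fun i _ => hC i).
  have jN' : (N <= j)%N by nat_lia.
  move=> /(_ jN') hh; apply: (le_trans (hh _)).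
    by move=> i /andP[ji ij]; apply: IH; nat_lia.
  rewrite le_eqVlt; apply/orP; left; apply/eqP; congr (_ * _).
  rewrite exprS -/th /K; field; rewrite gt_eqF//; lra.
have : (fun n => th ^+ n * C) @ \oo --> (0 * C : R).
  apply: cvgM; last exact: cvg_cst.
  by apply: cvg_expr; rewrite ger0_norm.
rewrite mul0r => /cvgrPdist_le /(_ (k' - K / (1 - th))).
have gap2 : 0 < k' - K / (1 - th).
  by rewrite subr_gt0 ltr_pdivrMr//; lra.
move=> /(_ gap2)[n _ /(_ n (leqnn n))]/=.
rewrite sub0r normrN ger0_norm; last by rewrite mulr_ge0 ?exprn_ge0// ltW.
move=> hn; have [N' hN'] := claim n.
exists N' => j jN'; rewrite (le_trans (hN' _ jN'))// ler_wpM2r//; last by lra.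
exact: ltW.
Qed.

End RenewalTail.

Section LatticeTail.
Context (R : realType).
Implicit Types b r : nat -> R.

(** A long-tailed sequence decays more slowly than any geometric one, so a
    geometric average that omits the last [L] terms is negligible. *)
Lemma geometric_convolution b (s : R) : (forall n, 0 < b n) ->
  (forall m n, (m <= n)%N -> b n <= b m) -> long_tailed_seq b ->
  0 < s < 1 -> forall e : R, 0 < e -> exists L N, forall n, (N <= n)%N ->
    \sum_(0 <= j < n - L) s ^+ (n - j) * b j <= e * b n.
Proof.
move=> b0 bdec bl /andP[s0 s1] e e0.
(* Any factor between 1 and 1 / s would do. *)
pose l := 2 / (1 + s).
have l1 : 1 < l by rewrite /l ltr_pdivlMr; lra.
have l0 : 0 < l by lra.
pose t := s * l.
have t1 : t < 1 by rewrite /t /l mulrA ltr_pdivrMr; lra.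
have t0 : 0 < t by rewrite /t mulr_gt0.
have [N hN] := bl _ l1.
have step n j : (N <= j)%N -> (j <= n)%N -> b j <= l ^+ (n - j) * b n.
  move=> Nj /subnK <-; elim: (n - j)%N => [|m IH].
    by rewrite add0n subnn expr0 mul1r.
  rewrite (le_trans IH)// !addnK exprSr -mulrA ler_pM2l ?exprn_gt0//.
  by rewrite addSn hN// (leq_trans Nj)// leq_addl.
pose C := b 0%N / b N + 1.
have C0 : 0 < C by rewrite /C ltr_wpDl// divr_ge0// ltW.
have C1 : 1 <= C by rewrite /C lerDr divr_ge0// ltW.
have bnd n j : (N <= n)%N -> (j <= n)%N -> b j <= C * l ^+ (n - j) * b n.
  move=> Nn jn; have [jN|Nj] := ltnP j N.
    have h1 : b N <= l ^+ (n - N) * b n by apply: step.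
    have h2 : l ^+ (n - N) <= l ^+ (n - j).
      by rewrite ler_eXn2l//; nat_lia.
    apply: (@le_trans _ _ (b 0%N / b N * b N)).
      by rewrite divfK ?gt_eqF// bdec.
    rewrite -(mulrA C); apply: ler_pM; [by rewrite divr_ge0// ltW|exact: ltW| |].
      by rewrite /C lerDl.
    by apply: (le_trans h1); rewrite ler_pM2r.
  rewrite (le_trans (step _ _ Nj jn))// -mulrA ler_peMl// mulr_ge0//;
    [apply: exprn_ge0|]; exact: ltW.
have : (fun n => t ^+ n * (C / (1 - t))) @ \oo --> (0 * (C / (1 - t)) : R).
  apply: cvgM; last exact: cvg_cst.
  by apply: cvg_expr; rewrite ger0_norm// ltW.
rewrite mul0r => /cvgrPdist_le /(_ _ e0)[L _ /(_ L (leqnn L))]/=.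
rewrite sub0r normrN ger0_norm; last first.
  by rewrite mulr_ge0 ?exprn_ge0 ?divr_ge0 ?ltW//; lra.
move=> hL; exists L, N => n Nn.
apply: (@le_trans _ _ (\sum_(0 <= j < n - L) C * t ^+ (n - j) * b n)).
  rewrite big_nat [leRHS]big_nat ler_sum// => j /andP[_ jn].
  have -> : C * t ^+ (n - j) * b n = s ^+ (n - j) * (C * l ^+ (n - j) * b n).
    by rewrite /t exprMn; ring.
  rewrite ler_wpM2l ?exprn_ge0//; first exact: ltW.
  by apply: bnd => //; nat_lia.
rewrite -big_distrl/= ler_wpM2r//; first exact: ltW.
apply: le_trans hL; rewrite -big_distrr/=.
have -> : \sum_(0 <= i < n - L) t ^+ (n - i) = t ^+ L.+1 * \sum_(0 <= i < n - L) t ^+ i.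
  rewrite big_nat_rev/= big_distrr/=.
  rewrite big_nat [RHS]big_nat; apply: eq_bigr => i /andP[_ ni].
  by rewrite -exprD; congr (_ ^+ _); nat_lia.
have geo m : \sum_(0 <= i < m) t ^+ i <= (1 - t)^-1.
  have : (\sum_(0 <= i < m) t ^+ i) * (1 - t) = 1 - t ^+ m.
    elim: m => [|m IH]; first by rewrite big_geq// mul0r expr0 subrr.
    by rewrite big_nat_recr//= mulrDl IH exprSr; ring.
  move=> E; rewrite -[_^-1]mul1r ler_pdivlMr; last by lra.
  by rewrite E lerBlDr lerDl exprn_ge0// ltW.
have tt : t ^+ L.+1 <= t ^+ L by rewrite exprS ler_piMl ?exprn_ge0// ltW.
have S0 : 0 <= \sum_(0 <= i < n - L) t ^+ i.
  by apply: sumr_ge0 => i _; apply: exprn_ge0; exact: ltW.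
have tL0 : 0 <= t ^+ L.+1 by apply: exprn_ge0; exact: ltW.
rewrite [leRHS]mulrCA ler_pM2l//.
exact: ler_pM.
Qed.

(** The form in which the tail [r] enters the bound on the work: a term at
    bounded distance plus a geometric average of [r] further back.  The slack
    between [k] and [k'] pays for the average and for the shift by [L + m]. *)
Lemma lattice_tail_le b r (s c k C k' : R) m : (forall n, 0 < b n) ->
  (forall i j, (i <= j)%N -> b j <= b i) -> long_tailed_seq b -> 0 < s < 1 ->
  0 < c -> 0 <= k -> k < k' -> 0 < C -> (forall j, r j <= C * b j) ->
  (exists N, forall j, (N <= j)%N -> r j <= k * b j) ->
  exists L N, forall n, (N <= n)%N ->
    r (n - L)%N + \sum_(0 <= j < n - L) s ^+ (n - j) * (r j / c) <=
    k' * b (n + m)%N.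
Proof.
move=> b0 bdec bl s01 c0 k0 kk' C0 rC [N1 rk].
pose g := (k' - k) / 2; have g0 : 0 < g by rewrite /g; lra.
have gE : k' = k + g + g by rewrite /g; lra.
have kg0 : 0 < k + g by lra.
pose l := k' / (k + g).
have l1 : 1 < l by rewrite /l ltr_pdivlMr// gE; lra.
have l0 : 0 < l by exact: lt_trans l1.
have Cc : 0 < C / c by exact: divr_gt0.
have eta0 : 0 < g / (C / c) by exact: divr_gt0.
have b_ge0 n : 0 <= b n by exact: ltW.
have [L [N2 hL]] := geometric_convolution b0 bdec bl s01 eta0.
have [N3 hN3] := long_tailed_shift (L + m) b_ge0 bl l1.
exists L, (N1 + N2 + N3 + L)%N => n hn.
have near_part : b (n - L)%N <= l * b (n + m)%N.
  have -> : (n + m = n - L + (L + m))%N by nat_lia.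
  by apply: hN3; nat_lia.
have sum_part : \sum_(0 <= j < n - L) s ^+ (n - j) * (r j / c) <= g * b (n - L)%N.
  apply: (@le_trans _ _ (C / c * \sum_(0 <= j < n - L) s ^+ (n - j) * b j)).
    rewrite mulr_sumr ler_sum// => j _.
    have -> : C / c * (s ^+ (n - j) * b j) = s ^+ (n - j) * (C * b j / c) by ring.
    rewrite ler_wpM2l ?exprn_ge0//; first by have /andP[/ltW] := s01.
    by rewrite ler_wpM2r// invr_ge0 ltW.
  apply: (@le_trans _ _ (C / c * (g / (C / c) * b n))).
    by rewrite ler_pM2l//; apply: hL; nat_lia.
  rewrite mulrA [C / c * _]mulrC divfK ?gt_eqF// ler_pM2l//.
  by apply: bdec; exact: leq_subr.
have r_part : r (n - L)%N <= k * b (n - L)%N by apply: rk; nat_lia.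
apply: (le_trans (lerD r_part sum_part)); rewrite -mulrDl.
apply: (@le_trans _ _ ((k + g) * (l * b (n + m)%N))); first by rewrite ler_pM2l.
by rewrite mulrA /l [(k + g) * _]mulrC divfK// gt_eqF.
Qed.

End LatticeTail.

(** * A Lyapunov function for two servers *)

Section Lyapunov.
Context (R : realType) (C : R) (C_gt0 : 0 < C).
Implicit Types (w : R * R) (y h s t : R).

(** At 0 its slope -1 is the rate at which an idle server loses work; its
    curvature [1 / C] is small when [C] is large. *)
Definition corrector y : R := Num.max 0 (C - y) ^+ 2 / (2 * C).

Definition corrector_slope y : R := Num.max 0 (C - y) / C.

Definition lyapunov w : R := w.1 + w.2 + corrector w.1.

Let c2_gt0 : 0 < 2 * C. Proof. by rewrite mulr_gt0. Qed.

Let correctorE y : corrector y * (2 * C) = Num.max 0 (C - y) ^+ 2.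
Proof. by rewrite /corrector divfK ?gt_eqF. Qed.

Lemma corrector_ge0 y : 0 <= corrector y.
Proof. by have C0 := C_gt0; rewrite /corrector divr_ge0 ?sqr_ge0 ?ltW. Qed.

Lemma corrector_le y : 0 <= y -> corrector y <= C / 2.
Proof.
have C0 := C_gt0.
move=> y0; rewrite -(ler_pM2r c2_gt0) correctorE.
by case: (leP 0 (C - y)); nra.
Qed.

Lemma corrector_slope_ge0 y : 0 <= corrector_slope y.
Proof. by have C0 := C_gt0; rewrite /corrector_slope divr_ge0 ?le_max ?lexx// ltW. Qed.

Lemma corrector_slope_le1 y : 0 <= y -> corrector_slope y <= 1.
Proof.
have C0 := C_gt0.
move=> y0; rewrite /corrector_slope ler_pdivrMr// mul1r ge_max.
by apply/andP; split; lra.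
Qed.

Lemma corrector_eq0 y : C <= y -> corrector y = 0.
Proof.
have C0 := C_gt0.
move=> Cy; rewrite /corrector max_l; last by lra.
by rewrite expr0n/= mul0r.
Qed.

Lemma corrector_nincr y z : y <= z -> corrector z <= corrector y.
Proof.
have C0 := C_gt0.
move=> yz; rewrite -(ler_pM2r c2_gt0) !correctorE.
by case: (leP 0 (C - y)); case: (leP 0 (C - z)); nra.
Qed.

(** Idling less cannot help: the work of the first server plus its corrector is
    monotone, since the corrector has slope at least -1. *)
Lemma corrector_pos_part_nd y z : y <= z ->
  Num.max 0 y + corrector (Num.max 0 y) <= Num.max 0 z + corrector (Num.max 0 z).
Proof.
have C0 := C_gt0.
move=> yz.
have key (u v : R) : 0 <= u -> u <= v -> u + corrector u <= v + corrector v.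
  move=> u0 uv; rewrite -(ler_pM2r c2_gt0) (mulrDl u) (mulrDl v) !correctorE.
  by case: (leP 0 (C - u)); case: (leP 0 (C - v)); nra.
apply: key; first by rewrite le_max lexx.
by rewrite ge_max !le_max lexx yz orbT.
Qed.

(** The idle time [max 0 (- y)] is paid for by the growth of the corrector on
    the negative half-line. *)
Lemma corrector_pos_part_le y :
  Num.max 0 y + corrector (Num.max 0 y) <= y + corrector y.
Proof.
have C0 := C_gt0.
have [//|/ltW y0] := leP 0 y.
rewrite add0r -(ler_pM2r c2_gt0) (mulrDl y) !correctorE.
by case: (leP 0 (C - y)); case: (leP 0 (C - 0)); nra.
Qed.

Lemma corrector_taylor y h :
  corrector (y + h) <= corrector y - corrector_slope y * h + h ^+ 2 / (2 * C).
Proof.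
have C0 := C_gt0.
rewrite -(ler_pM2r c2_gt0) (mulrDl (corrector y - _)) mulrBl !correctorE.
rewrite divfK ?gt_eqF//.
rewrite (_ : corrector_slope y * h * (2 * C) = 2 * Num.max 0 (C - y) * h); last first.
  by rewrite /corrector_slope; field; rewrite gt_eqF.
by case: (leP 0 (C - y)); case: (leP 0 (C - (y + h))); nra.
Qed.

Let next w s t := pos_part (ascending (w.1 + s - t, w.2 - t)).

Lemma lyapunov_next_low w s t : 0 <= w.1 <= w.2 -> 0 <= s -> 0 <= t ->
  w.2 - t < C -> lyapunov (next w s t) <= 3 * C + s.
Proof.
have C0 := C_gt0.
case: w => w1 w2 /= /andP[w0 w12] s0 t0 wC.
rewrite /lyapunov /next /=.
have := corrector_le (_ : 0 <= Num.max 0 (Num.min (w1 + s - t) (w2 - t))).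
rewrite le_max lexx => /(_ isT).
move: (corrector _) => z zC.
case: (leP (w1 + s - t) (w2 - t)) => ?;
  case: (leP 0 (w1 + s - t)) => ?; case: (leP 0 (w2 - t)) => ?; lra.
Qed.

(** When the second server stays above [C], exchanging the servers does not
    matter: the corrector vanishes above [C] and is decreasing. *)
Lemma lyapunov_next_high w s t : 0 <= w.1 <= w.2 -> 0 <= s -> 0 <= t ->
  C <= w.2 - t ->
  let y := Num.max 0 (w.1 + s - t) in
  lyapunov (next w s t) <= w.2 - t + (y + corrector y).
Proof.
have C0 := C_gt0.
case: w => w1 w2 /= /andP[w0 w12] s0 t0 wC.
rewrite /lyapunov /next /=.
case: (leP (w1 + s - t) (w2 - t)) => h.
  by rewrite [X in _ + X + _]max_r; lra.
rewrite (@max_r _ _ 0 (w2 - t)); last by lra.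
rewrite (@max_r _ _ 0 (w1 + s - t)); last by lra.
by rewrite !corrector_eq0; lra.
Qed.

Lemma lyapunov_next w s t : 0 <= w.1 <= w.2 -> 0 <= s -> 0 <= t ->
  lyapunov (next w s t) <= Num.max (lyapunov w + s) (3 * C + s).
Proof.
have C0 := C_gt0.
move=> w12 s0 t0; rewrite le_max.
case: (ltP (w.2 - t) C) => h; first by rewrite lyapunov_next_low ?orbT.
rewrite (le_trans (lyapunov_next_high _ _ _ h))//.
have [w0 _] := andP w12.
have h1 : w.1 + s - t <= w.1 + s by lra.
have := corrector_pos_part_nd h1.
rewrite (@max_r _ _ 0 (w.1 + s)); last by lra.
have : corrector (w.1 + s) <= corrector w.1 by apply: corrector_nincr; lra.
by rewrite /lyapunov; lra.
Qed.

(** The interarrival time is capped by [T] so that the quadratic error of the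
    Taylor expansion of the corrector is bounded; capping only raises the bound
    by monotonicity. *)
Lemma lyapunov_next_drift w s t K T e : 0 <= w.1 <= w.2 -> 0 <= s <= K -> 0 <= t ->
  0 <= T -> K ^+ 2 + T ^+ 2 <= 2 * C * e ->
  let t' := Num.min t T in
  lyapunov (next w s t) <=
    Num.max (lyapunov w + (s - 2 * t' - corrector_slope w.1 * (s - t') + e))
      (3 * C + s).
Proof.
have C0 := C_gt0.
move=> w12 /andP[s0 sK] t0 T0 KT /=; rewrite le_max.
case: (ltP (w.2 - t) C) => h; first by rewrite lyapunov_next_low ?orbT.
apply/orP; left.
rewrite (le_trans (lyapunov_next_high _ _ _ h))//.
have [w0 _] := andP w12.
set t' := Num.min t T.
have [t'0 t't t'T] : [/\ 0 <= t', t' <= t & t' <= T].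
  by rewrite /t' le_min t0 T0 !ge_min !lexx orbT.
have h1 : w.1 + s - t <= w.1 + (s - t') by lra.
have := corrector_pos_part_nd h1.
have := corrector_pos_part_le (w.1 + (s - t')).
have := corrector_taylor w.1 (s - t').
have : (s - t') ^+ 2 / (2 * C) <= e.
  by rewrite ler_pdivrMr//; nra.
by rewrite /lyapunov; lra.
Qed.

End Lyapunov.

Section QueueState.
Context (R : realType) (T : Type) (tau sigma : nat -> T -> R).

Lemma residual_work_sorted n t :
  let w := residual_work tau sigma n t in 0 <= w.1 <= w.2.
Proof.
elim: n => [|n _] /=; first by rewrite lexx.
rewrite le_max lexx/= ge_max !le_max lexx/=.
by rewrite !ge_min !lexx !orbT.
Qed.

End QueueState.

(** * Independence of the past and the next customer *)

Section Independence.
Context d (T : measurableType d) (R : realType) (P : probability T R).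
Local Open Scope ereal_scope.

(** Dynkin's argument: the events independent of [E0] form a lambda-system. *)
Lemma indep_pi_system (G : set (set T)) (E0 : set T) : setI_closed G ->
  G `<=` measurable -> measurable E0 ->
  (forall E, G E -> P (E `&` E0) = P E * P E0) ->
  forall E, <<s G >> E -> P (E `&` E0) = P E * P E0.
Proof.
move=> GI Gm mE0 GE.
have sGm : <<s G >> `<=` @measurable _ T.
  by apply: smallest_sub => //; exact: sigma_algebra_measurable.
have fin E : measurable E -> P E \is a fin_num by exact: fin_num_measure.
pose T' : measurableType _ := g_sigma_algebraType G.
apply: (@dynkin_induction _ T' G (fun E => P (E `&` E0) = P E * P E0)) => //.
- by rewrite setTI probability_setT mul1e.
- move=> S mS PS.
  have {}mS : measurable (S : set T) by exact: sGm.
  have -> : P (~` S `&` E0) = P E0 - P (S `&` E0).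
    rewrite setIC -setDE (setIC S); apply: measureD => //.
    by rewrite ltey_eq fin_num_measure.
  by rewrite PS probability_setC// muleBl ?mul1e ?fin//.
- move=> F mF tF PF.
  have {}mF n : measurable (F n : set T) by apply: sGm; exact: mF.
  have -> : P (\bigcup_k F k `&` E0) =
      \sum_(k <oo | k \in [set: nat]) P (F k `&` E0).
    rewrite setI_bigcupl; apply: measure_bigcup.
      by move=> i _; exact: measurableI.
    exact: trivIset_setIr.
  have -> : P (\bigcup_k F k) = \sum_(k <oo | k \in [set: nat]) P (F k).
    exact: measure_bigcup.
  rewrite muleC -[P E0]fineK ?fin// -nneseriesZl//.
  by apply: eq_eseriesr => i _; rewrite fineK ?fin// muleC.
Qed.

Lemma indep_ge0_integral (X Y : T -> R) : measurable_fun setT X ->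
  measurable_fun setT Y -> (forall t, (0 <= X t)%R) -> (forall t, (0 <= Y t)%R) ->
  (forall A B, measurable A -> measurable B ->
    P (X @^-1` A `&` Y @^-1` B) = P (X @^-1` A) * P (Y @^-1` B)) ->
  \int[P]_t (X t * Y t)%:E = \int[P]_t (X t)%:E * \int[P]_t (Y t)%:E.
Proof.
move=> mX mY X0 Y0 XY.
pose X' : {mfun T >-> R} := HB.pack X (isMeasurableFun.Build _ _ _ _ _ mX).
pose Y' : {mfun T >-> R} := HB.pack Y (isMeasurableFun.Build _ _ _ _ _ mY).
have mXY : measurable_fun setT (fun t => (X t, Y t)) by exact: measurable_fun_pair.
pose Z : {mfun T >-> (R * R)%type} :=
  HB.pack (fun t => (X t, Y t)) (isMeasurableFun.Build _ _ _ _ _ mXY).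
pose f (p : (R * R)%type) : \bar R := (Num.max 0 p.1 * Num.max 0 p.2)%R%:E.
have mf : measurable_fun [set: (R * R)%type] f.
  apply/measurable_EFinP; apply: measurable_funM.
    by apply: measurable_maxr => //; exact: measurable_fst.
  by apply: measurable_maxr => //; exact: measurable_snd.
have f0 p : 0 <= f p by rewrite lee_fin mulr_ge0// le_max lexx.
transitivity (\int[distribution P Z]_p f p).
  rewrite ge0_integral_distribution//; apply: eq_integral => t _ /=.
  by rewrite /f/= !max_r.
transitivity (\int[(distribution P X' \x distribution P Y')]_p f p).
  apply: eq_measure_integral => A mA _; apply/esym.
  apply: product_measure_unique => //.
rewrite fubini_tonelli1// /fubini_F.
under eq_integral => x _.
  under eq_integral => y _ do rewrite /f/= EFinM.
  rewrite ge0_integralZl//; last 3 first.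
  - by apply/measurable_EFinP; exact: measurable_maxr.
  - by move=> y _; rewrite lee_fin le_max lexx.
  - by rewrite lee_fin le_max lexx.
  over.
rewrite ge0_integralZr//; last 3 first.
- by apply/measurable_EFinP; exact: measurable_maxr.
- by move=> y _; rewrite lee_fin le_max lexx.
- by apply: integral_ge0 => y _; rewrite lee_fin le_max lexx.
congr (_ * _); rewrite ge0_integral_distribution//.
- by apply: eq_integral => t _ /=; rewrite max_r.
- by apply/measurable_EFinP; exact: measurable_maxr.
- by move=> y; rewrite lee_fin le_max lexx.
- by apply: eq_integral => t _ /=; rewrite max_r.
- by apply/measurable_EFinP; exact: measurable_maxr.
- by move=> y; rewrite lee_fin le_max lexx.
Qed.

Lemma mutually_independent_initial (X : nat -> {RV P >-> R}) n (A : nat -> set R) :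
  mutually_independent X -> (forall i, measurable (A i)) ->
  P (\bigcap_(i in `I_n) X i @^-1` A i) = \prod_(0 <= i < n) P (X i @^-1` A i).
Proof.
move=> iX mA.
have := iX [fset i in iota 0 n]%fset A mA.
rewrite (_ : [set` _] = `I_n); last first.
  by apply/seteqP; split => i /=; rewrite !inE mem_iota add0n.
move=> ->.
apply: perm_big.
rewrite /index_iota subn0; apply: uniq_perm; rewrite ?fset_uniq ?iota_uniq// => i.
by rewrite !inE.
Qed.

End Independence.

Section History.
Context d (T : measurableType d) (R : realType) (P : probability T R).
Local Open Scope ereal_scope.
Context (tau sigma : nat -> {RV P >-> R}).
Context (tau_iid : iid tau) (sigma_iid : iid sigma).
Context (indep : independent_sequences tau sigma).

Definition rectangle m (X : nat -> {RV P >-> R}) (A : nat -> set R) : set T :=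
  \bigcap_(i in `I_m) X i @^-1` A i.

(** A pi-system generating the information available when customer [n] arrives:
    the first [n] service times, and the interarrival times of index at most
    [n]. *)
Definition past_rectangles n : set (set T) :=
  [set E | exists2 AB : (nat -> set R) * (nat -> set R),
    (forall i, measurable (AB.1 i)) /\ (forall i, measurable (AB.2 i)) &
    E = rectangle n sigma AB.1 `&` rectangle n.+1 tau AB.2].

Definition past n : measurableType _ := g_sigma_algebraType (past_rectangles n).

Lemma rectangle_generated m (X : nat -> {RV P >-> R}) A :
  (forall i, measurable (A i)) -> sigma_generated X (rectangle m X A).
Proof.
move=> mA; pose GX := \bigcup_n preimage_set_system setT (X n) measurable.
pose T' : measurableType _ := g_sigma_algebraType GX.
rewrite /rectangle bigcap_mkcond.
apply: (@bigcapT_measurable _ T') => i.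
case: ifP => _; last exact: measurableT.
apply: sub_gen_smallest; exists i => //; exists (A i) => //.
by rewrite setTI.
Qed.

Lemma measurable_rectangle m (X : nat -> {RV P >-> R}) A :
  (forall i, measurable (A i)) -> measurable (rectangle m X A).
Proof.
move=> mA; rewrite /rectangle bigcap_mkcond.
apply: bigcapT_measurable => i.
case: ifP => _; last exact: measurableT.
by rewrite -[_ @^-1` _]setTI; exact: measurable_funPT.
Qed.

Lemma rectangleI m X A B :
  rectangle m X A `&` rectangle m X B = rectangle m X (fun i => A i `&` B i).
Proof.
rewrite /rectangle -bigcapI.
by apply: eq_bigcapr => i _; rewrite preimage_setI.
Qed.

Lemma rectangleS m X A B : rectangle m X A `&` X m @^-1` B =
  rectangle m.+1 X (fun i => if i == m then B else A i).
Proof.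
apply/seteqP; split => t; rewrite /rectangle /=.
  move=> [h1 h2] i /=; rewrite ltnS leq_eqVlt => /orP[/eqP->|im].
    by rewrite eqxx.
  by rewrite ltn_eqF//; exact: h1.
move=> h; split => [i im|]; last by have := h m (leqnn _); rewrite /= eqxx.
have := h i; rewrite /= ltn_eqF//; apply; exact: (ltn_trans im).
Qed.

Lemma past_rectangles_setI n : setI_closed (past_rectangles n).
Proof.
move=> _ _ [[A B]/= [mA mB] ->] [[A' B']/= [mA' mB'] ->].
exists (fun i => A i `&` A' i, fun i => B i `&` B' i) => /=.
  by split => i; exact: measurableI.
by rewrite setIACA !rectangleI.
Qed.

Lemma past_rectangles_measurable n : past_rectangles n `<=` measurable.
Proof.
by move=> _ [[A B]/= [mA mB] ->]; apply: measurableI; exact: measurable_rectangle.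
Qed.

Lemma rectangle_proba m (X : nat -> {RV P >-> R}) A B : mutually_independent X ->
  (forall i, measurable (A i)) -> measurable B ->
  P (rectangle m X A `&` X m @^-1` B) = P (rectangle m X A) * P (X m @^-1` B).
Proof.
move=> iX mA mB; rewrite rectangleS /rectangle !mutually_independent_initial//.
  rewrite big_nat_recr//= eqxx; congr (_ * _).
  by rewrite big_nat [RHS]big_nat; apply: eq_bigr => i /andP[_ im]; rewrite ltn_eqF.
by move=> i; case: ifP.
Qed.

(** On a rectangle, the interarrival part splits off by independence of the two
    sequences, and the service part by mutual independence. *)
Lemma past_indep_sigma n E B : <<s past_rectangles n >> E -> measurable B ->
  P (E `&` sigma n @^-1` B) = P E * P (sigma n @^-1` B).
Proof.
move=> sE mB; apply: indep_pi_system sE; first exact: past_rectangles_setI.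
- exact: past_rectangles_measurable.
- by rewrite -[_ @^-1` _]setTI; exact: measurable_funPT.
move=> _ [[A1 A2]/= [m1 m2] ->].
rewrite -setIA setIC -setIA [X in _ `&` X]setIC.
rewrite indep//; last 2 first.
- exact: rectangle_generated.
- rewrite rectangleS; apply: rectangle_generated => i.
  by case: ifP.
rewrite rectangle_proba//; last by case: sigma_iid.
rewrite muleA; congr (_ * _); rewrite [in RHS]setIC indep//.
- exact: rectangle_generated.
- exact: rectangle_generated.
Qed.

Lemma past_indep_tau n E B : <<s past_rectangles n >> E -> measurable B ->
  P (E `&` tau n.+1 @^-1` B) = P E * P (tau n.+1 @^-1` B).
Proof.
move=> sE mB; apply: indep_pi_system sE; first exact: past_rectangles_setI.
- exact: past_rectangles_measurable.
- by rewrite -[_ @^-1` _]setTI; exact: measurable_funPT.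
move=> _ [[A1 A2]/= [m1 m2] ->].
rewrite -setIA setIC.
rewrite indep//; last 2 first.
- rewrite rectangleS; apply: rectangle_generated => i.
  by case: ifP.
- exact: rectangle_generated.
rewrite rectangle_proba//; last by case: tau_iid.
rewrite muleAC; congr (_ * _); rewrite [in RHS]setIC indep//.
- exact: rectangle_generated.
- exact: rectangle_generated.
Qed.

End History.

(** * Expectations of bounded random variables *)

Section BoundedFunctions.
Context d (T : measurableType d) (R : realType).
Implicit Types f g : T -> R.

Definition bounded_measurable f :=
  measurable_fun setT f /\ exists M, forall t, `|f t| <= M.

Lemma bounded_measurable_cst (c : R) : bounded_measurable (fun _ => c).
Proof. by split => //; exists `|c|. Qed.

Lemma bounded_measurableD f g : bounded_measurable f -> bounded_measurable g ->
  bounded_measurable (fun t => f t + g t).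
Proof.
move=> [mf [M hM]] [mg [N hN]]; split; first exact: measurable_funD.
by exists (M + N) => t; rewrite (le_trans (ler_normD _ _))// lerD.
Qed.

Lemma bounded_measurableM f g : bounded_measurable f -> bounded_measurable g ->
  bounded_measurable (fun t => f t * g t).
Proof.
move=> [mf [M hM]] [mg [N hN]]; split; first exact: measurable_funM.
by exists (M * N) => t; rewrite normrM ler_pM.
Qed.

Lemma bounded_measurableN f : bounded_measurable f ->
  bounded_measurable (fun t => - f t).
Proof.
move=> [mf [M hM]]; split; first exact: measurable_funN.
by exists M => t; rewrite normrN.
Qed.

Lemma bounded_measurable_sum (F : nat -> T -> R) s :
  (forall i, bounded_measurable (F i)) ->
  bounded_measurable (fun t => \sum_(i <- s) F i t).
Proof.
move=> bF; elim: s => [|i s IH].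
  rewrite (_ : (fun _ => _) = fun=> 0); first exact: bounded_measurable_cst.
  by apply/funext => t; rewrite big_nil.
rewrite (_ : (fun _ => _) = fun t => F i t + \sum_(j <- s) F j t).
  exact: bounded_measurableD.
by apply/funext => t; rewrite big_cons.
Qed.

Lemma bounded_measurable_bool (b : T -> bool) : measurable_fun setT b ->
  bounded_measurable (fun t => (b t)%:R).
Proof.
move=> mb; split; last by exists 1 => t; rewrite ger0_norm ?ler0n// lern1 leq_b1.
rewrite (_ : (fun _ => _) = (fun t => if b t then 1 else 0)); last first.
  by apply/funext => t; case: (b t).
exact: measurable_fun_ifT.
Qed.

Lemma bounded_measurable_between f a b : measurable_fun setT f ->
  (forall t, a <= f t <= b) -> bounded_measurable f.
Proof.
move=> mf hf; split=> //; exists (`|a| + `|b|) => t.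
have /andP[h1 h2] := hf t.
rewrite ler_norml; apply/andP; split.
  have := ler_norm (- a); rewrite normrN; have := normr_ge0 b; lra.
have := ler_norm b; have := normr_ge0 a; lra.
Qed.

Context (P : probability T R).

Lemma bounded_measurable_integrable f : bounded_measurable f ->
  P.-integrable setT (EFin \o f).
Proof.
move=> [mf [M hM]]; apply: measurable_bounded_integrable => //.
  by rewrite [X in (X < _)%E]probability_setT ltry.
exists M; split; first exact: num_real.
by move=> x Mx t _ /=; rewrite (le_trans (hM t))// ltW.
Qed.

End BoundedFunctions.

Notation "''Ex_' P [ f ]" := (Rintegral P setT f)
  (P at level 8, at level 10, format "''Ex_' P [ f ]").

Section Expectation.
Context d (T : measurableType d) (R : realType) (P : probability T R).
Implicit Types f g : T -> R.

Lemma Ex_cst (c : R) : 'Ex_P[fun _ => c] = c.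
Proof. by rewrite Rintegral_cst// [X in fine X]probability_setT mulr1. Qed.

Lemma Ex_ge0 f : (forall t, 0 <= f t) -> 0 <= 'Ex_P[f].
Proof. by move=> f0; apply: Rintegral_ge0. Qed.

Lemma ExD f g : bounded_measurable f -> bounded_measurable g ->
  'Ex_P[fun t => f t + g t] = 'Ex_P[f] + 'Ex_P[g].
Proof. by move=> bf bg; rewrite RintegralD//; exact: bounded_measurable_integrable. Qed.

Lemma ExZ (c : R) f : bounded_measurable f ->
  'Ex_P[fun t => c * f t] = c * 'Ex_P[f].
Proof. by move=> bf; rewrite RintegralZl//; exact: bounded_measurable_integrable. Qed.

Lemma Ex_le f g : bounded_measurable f -> bounded_measurable g ->
  (forall t, f t <= g t) -> 'Ex_P[f] <= 'Ex_P[g].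
Proof.
move=> bf bg fg.
by apply: le_Rintegral => //; exact: bounded_measurable_integrable.
Qed.

Lemma Ex_sum (F : nat -> T -> R) m n : (forall i, bounded_measurable (F i)) ->
  'Ex_P[fun t => \sum_(m <= i < n) F i t] = \sum_(m <= i < n) 'Ex_P[F i].
Proof.
move=> bF; elim: (index_iota m n) => [|i s IH].
  rewrite [X in Rintegral _ _ X](_ : _ = fun=> 0) ?Ex_cst ?big_nil//.
  by apply/funext => t; rewrite big_nil.
rewrite [X in Rintegral _ _ X](_ : _ =
    fun t => F i t + \sum_(j <- s) F j t); last first.
  by apply/funext => t; rewrite big_cons.
rewrite ExD//; first by rewrite IH big_cons.
exact: bounded_measurable_sum.
Qed.

Lemma Ex_bool (b : T -> bool) : measurable_fun setT b ->
  'Ex_P[fun t => (b t)%:R] = fine (P [set t | b t]).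
Proof.
move=> mb.
have mB : measurable [set t | b t].
  by have := mb measurableT [set true] Logic.I; rewrite setTI.
rewrite /Rintegral -(setIT [set t | b t]) -integral_indic//.
congr fine; apply: eq_integral => t _; rewrite indicE.
by case: (boolP (b t)) => bt; [rewrite mem_set|rewrite memNset//=; exact/negP].
Qed.

End Expectation.

Section HistoryExpectation.
Context d (T : measurableType d) (R : realType) (P : probability T R).
Context (tau sigma : nat -> {RV P >-> R}).
Context (tau_iid : iid tau) (sigma_iid : iid sigma).
Context (indep : independent_sequences tau sigma).

Local Notation past := (past tau sigma).

Lemma past_sub n : <<s past_rectangles tau sigma n >> `<=`
  <<s past_rectangles tau sigma n.+1 >>.
Proof.
apply: sub_smallest2r => // _ [[A B]/= [mA mB] ->].
exists (fun i => if (i < n)%N then A i else setT,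
        fun i => if (i < n.+1)%N then B i else setT).
  by split => i /=; case: ifP.
congr (_ `&` _); rewrite /= /rectangle; apply/seteqP; split => t h i /= ilt.
- by case: ifP => // ?; exact: h.
- by have := h i (ltnW ilt); rewrite /= ilt.
- by case: ifP => // ?; exact: h.
- by have := h i (ltnW ilt); rewrite /= ilt.
Qed.

Lemma past_measurable_sub n : <<s past_rectangles tau sigma n >> `<=` measurable.
Proof.
apply: smallest_sub; first exact: sigma_algebra_measurable.
exact: past_rectangles_measurable.
Qed.

Lemma past_measurable_funS n (f : T -> R) :
  measurable_fun [set: past n] f -> measurable_fun [set: past n.+1] f.
Proof. by move=> mf _ A mA; apply: past_sub; exact: mf. Qed.

Lemma past_measurable_fun n (f : T -> R) :
  measurable_fun [set: past n] f -> measurable_fun [set: T] f.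
Proof. by move=> mf _ A mA; apply: past_measurable_sub; exact: mf. Qed.

Lemma past_bounded_measurable n (f : T -> R) :
  bounded_measurable (f : past n -> R) -> bounded_measurable (f : T -> R).
Proof. by move=> [mf bf]; split => //; exact: past_measurable_fun mf. Qed.

Lemma past_measurable_sigma n : measurable_fun [set: past n.+1] (sigma n).
Proof.
move=> _ A mA; rewrite setTI; apply: sub_gen_smallest.
exists (fun i => if i == n then A else setT, fun=> setT) => /=.
  by split => // i; case: ifP.
rewrite /rectangle; apply/seteqP; split => t /=.
  move=> At; split => i //= _.
  by case: ifPn => // /eqP ->.
by move=> [/(_ n (leqnn _))]; rewrite /= eqxx.
Qed.

Lemma past_measurable_tau n : measurable_fun [set: past n] (tau n).
Proof.
move=> _ A mA; rewrite setTI; apply: sub_gen_smallest.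
exists (fun=> setT, fun i => if i == n then A else setT) => /=.
  by split => // i; case: ifP.
rewrite /rectangle; apply/seteqP; split => t /=.
  move=> At; split => i //= _.
  by case: ifPn => // /eqP ->.
by move=> [_ /(_ n (leqnn _))]; rewrite /= eqxx.
Qed.

Lemma Ex_iid (X : nat -> {RV P >-> R}) (f : R -> R) n : iid X ->
  measurable_fun setT f -> (forall x, 0 <= f x) ->
  'Ex_P[f \o X n] = 'Ex_P[f \o X 0%N].
Proof.
move=> [_ idX] mf f0; rewrite /Rintegral; congr fine.
have mf' : measurable_fun setT (EFin \o f) by exact/measurable_EFinP.
have f0' x : (0 <= (EFin \o f) x)%E by rewrite lee_fin.
have := @ge0_integral_distribution _ _ _ _ _ P (X n) _ mf' f0'.
have := @ge0_integral_distribution _ _ _ _ _ P (X 0%N) _ mf' f0'.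
rewrite /comp /= => <- <-.
by apply: eq_measure_integral => A mA _; exact: idX.
Qed.

Lemma Ex_mul (X Y : T -> R) : bounded_measurable X -> bounded_measurable Y ->
  (forall t, 0 <= X t) -> (forall t, 0 <= Y t) ->
  (forall A B, measurable A -> measurable B ->
    P (X @^-1` A `&` Y @^-1` B) = (P (X @^-1` A) * P (Y @^-1` B))%E) ->
  'Ex_P[fun t => X t * Y t] = 'Ex_P[X] * 'Ex_P[Y].
Proof.
move=> bX bY X0 Y0 XY; rewrite /Rintegral indep_ge0_integral//; last 2 first.
- by case: bX.
- by case: bY.
have fX := integrable_fin_num measurableT (bounded_measurable_integrable P bX).
have fY := integrable_fin_num measurableT (bounded_measurable_integrable P bY).
by rewrite fineM.
Qed.

(** The two factorizations [Ex_past_sigma] and [Ex_past_tau] are the only use of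
    independence in the sequel. *)
Lemma Ex_past_sigma n (Y : T -> R) (f : R -> R) :
  bounded_measurable (Y : past n -> R) -> (forall t, 0 <= Y t) ->
  measurable_fun setT f -> (forall x, 0 <= f x) ->
  bounded_measurable (f \o sigma n) ->
  'Ex_P[fun t => Y t * f (sigma n t)] = 'Ex_P[Y] * 'Ex_P[f \o sigma 0%N].
Proof.
move=> bY Y0 mf f0 bf.
rewrite -(Ex_iid n sigma_iid mf f0) -(Ex_mul _ bf) //.
- exact: past_bounded_measurable bY.
- by move=> t /=.
- move=> A B mA mB.
  have sA : <<s past_rectangles tau sigma n >> (Y @^-1` A).
    by case: bY => mY _; have := mY measurableT A mA; rewrite setTI.
  have mB' : measurable (f @^-1` B) by rewrite -[_ @^-1` _]setTI; exact: mf.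
  exact: (past_indep_sigma sigma_iid indep sA mB').
Qed.

Lemma Ex_past_tau n (Y : T -> R) (f : R -> R) :
  bounded_measurable (Y : past n -> R) -> (forall t, 0 <= Y t) ->
  measurable_fun setT f -> (forall x, 0 <= f x) ->
  bounded_measurable (f \o tau n.+1) ->
  'Ex_P[fun t => Y t * f (tau n.+1 t)] = 'Ex_P[Y] * 'Ex_P[f \o tau 0%N].
Proof.
move=> bY Y0 mf f0 bf.
rewrite -(Ex_iid n.+1 tau_iid mf f0) -(Ex_mul _ bf) //.
- exact: past_bounded_measurable bY.
- by move=> t /=.
- move=> A B mA mB.
  have sA : <<s past_rectangles tau sigma n >> (Y @^-1` A).
    by case: bY => mY _; have := mY measurableT A mA; rewrite setTI.
  have mB' : measurable (f @^-1` B) by rewrite -[_ @^-1` _]setTI; exact: mf.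
  exact: (past_indep_tau tau_iid indep sA mB').
Qed.

End HistoryExpectation.

(** * A pathwise dominating process *)

Section ExpBound.
Context (R : realType).

(** From [1 - x <= exp (- x)] and [(1 - x) (1 + x + 2 x^2) >= 1]. *)
Lemma expR_le_quadratic (x : R) : x <= 1 / 2 -> expR x <= 1 + x + 2 * x ^+ 2.
Proof.
move=> x12; have h : 1 - x <= expR (- x) by exact: expR_ge1Dx.
have x1 : 0 < 1 - x by lra.
have : expR x * (1 - x) <= 1.
  apply: (@le_trans _ _ (expR x * expR (- x))).
    by rewrite ler_pM2l ?expR_gt0.
  by rewrite expRxMexpNx_1.
move=> hx; rewrite -(ler_pM2r x1) (le_trans hx)//; nra.
Qed.

End ExpBound.

Section DominatingProcess.
Context (R : realType) (T : Type) (tau sigma : nat -> T -> R).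
Context (C K cap u e th : R).
Context (tau_ge0 : forall n t, 0 <= tau n t).
Context (sigma_ge0 : forall n t, 0 <= sigma n t).
Context (C_gt0 : 0 < C) (K_ge0 : 0 <= K) (cap_ge0 : 0 <= cap) (u_gt0 : 0 < u).
Context (e_gt0 : 0 < e) (th_gt0 : 0 < th).
Context (C_large : K ^+ 2 + cap ^+ 2 <= 2 * C * e).

(** The summand 2 accounts for the unit by which the chain goes down at each
    step and for rounding up: [u * jump s >= s + u] when [K < s]. *)
Definition jump (s : R) : nat := if s <= K then 0%N else (Num.trunc (s / u)).+2.

Definition slope n t : R := corrector_slope C (residual_work tau sigma n t).1.

(** A bound on the increment of the Lyapunov function over a customer whose
    service time is at most [K], augmented by [u]. *)
Definition drift n t : R :=
  let t' := Num.min (tau n.+1 t) cap in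
  sigma n t - 2 * t' + u - slope n t * (sigma n t - t') + e.

Definition drift_bound : R := K + 2 * cap + u + e.

Context (th_small : th * drift_bound <= 1 / 2).

(** A bound on [exp (th * drift)], affine in the service time and in the capped
    interarrival time, so that its mean can be computed by independence. *)
Definition growth n t : R := 1 + th * drift n t + 2 * (th * drift_bound) ^+ 2.

Fixpoint jumps n t : nat :=
  if n is m.+1 then (jumps m t + jump (sigma m t)).-1 else 0.

(** The term 1 covers both the moment when the Lyapunov function falls back to a
    bounded level and the reflection of [jumps] at 0. *)
Fixpoint weight n t : R :=
  if n is m.+1 then
    (sigma m t <= K)%R%:R * (1 + weight m t * growth m t)
    + (1 - (sigma m t <= K)%R%:R) * weight m t
  else 1.

Lemma slope_bounds n t : 0 <= slope n t <= 1.
Proof.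
have C0 := C_gt0.
have /andP[w0 _] := residual_work_sorted tau sigma n t.
by rewrite /slope corrector_slope_ge0// corrector_slope_le1.
Qed.

Lemma drift_bounds n t : sigma n t <= K ->
  - drift_bound <= drift n t <= drift_bound.
Proof.
have [[C0 K0] c0] := (C_gt0, K_ge0, cap_ge0).
have [u0 e0] := (u_gt0, e_gt0).
have s0 := sigma_ge0 n t; have t0 := tau_ge0 n.+1 t.
rewrite /drift; set s := sigma n t in s0 *.
have : 0 <= Num.min (tau n.+1 t) cap <= cap by rewrite le_min t0 c0 ge_min lexx orbT.
move: (Num.min _ _) => t' /andP[t'0 t'c] sK.
have /andP[k0 k1] := slope_bounds n t; rewrite /drift_bound.
move: (slope n t) k0 k1 => k k0 k1.
have h1 : 0 <= (1 - k) * s <= K by nra.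
have h2 : 0 <= (2 - k) * t' <= 2 * cap by nra.
by apply/andP; split; lra.
Qed.

Lemma th_drift n t : sigma n t <= K -> - (1 / 2) <= th * drift n t <= 1 / 2.
Proof.
move=> sK; have /andP[h1 h2] := drift_bounds sK; have th0 := th_gt0.
have h := th_small; apply/andP; split; nra.
Qed.

Lemma growth_ge_exp n t : sigma n t <= K -> expR (th * drift n t) <= growth n t.
Proof.
move=> sK; have /andP[h1 h2] := th_drift sK.
apply: (le_trans (expR_le_quadratic h2)).
have /andP[d1 d2] := drift_bounds sK; have th0 := th_gt0.
have x1 : th * drift n t <= th * drift_bound by rewrite ler_pM2l.
have x2 : - (th * drift_bound) <= th * drift n t by rewrite -mulrN ler_pM2l.
rewrite /growth lerD2l ler_pM2l//.
move: (th * drift n t) (th * drift_bound) x1 x2 => x y x1 x2; nra.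
Qed.

Lemma growth_bounds n t : sigma n t <= K -> 0 <= growth n t <= 2.
Proof.
move=> sK; rewrite (le_trans _ (growth_ge_exp sK)) ?expR_ge0//=.
have /andP[h1 h2] := th_drift sK; have th0 := th_gt0.
have B0 : 0 <= th * drift_bound.
  have [[C0 K0] c0] := (C_gt0, K_ge0, cap_ge0).
  have [u0 e0] := (u_gt0, e_gt0).
  by rewrite mulr_ge0//; [lra|rewrite /drift_bound; lra].
have h := th_small; rewrite /growth.
move: (th * drift n t) (th * drift_bound) h1 h2 B0 h => x y h1 h2 B0 h; nra.
Qed.

Lemma weight_bounds n t : 1 <= weight n t <= 3 ^+ n.+1.
Proof.
elim: n => [|n /andP[w1 w2]]; first by rewrite /= lexx expr1; lra.
rewrite exprS /=; move: (3 ^+ n.+1) w2 => Z w2.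
case: (leP (sigma n t) K) => sK.
  have /andP[g0 g2] := growth_bounds sK.
  rewrite mul1r subrr mul0r addr0; apply/andP; split; nra.
rewrite mul0r add0r subr0 mul1r; apply/andP; split; lra.
Qed.

Lemma jumpE s : K < s -> jump s = (Num.trunc (s / u)).+2.
Proof. by move=> Ks; rewrite /jump leNgt Ks. Qed.

Lemma jump_eq0 s : (jump s == 0)%N = (s <= K).
Proof. by rewrite /jump; case: ifP. Qed.

(** Customers with a short service time multiply the left-hand side by at most
    [exp (th * drift)]; those with a long one do not increase it, since [jumps]
    absorbs their whole service time. *)
Lemma weight_dominates n t :
  expR (th * (lyapunov C (residual_work tau sigma n t) - (3 * C + K)
              - u * (jumps n t)%:R)) <= weight n t.
Proof.
have [[C0 K0] c0] := (C_gt0, K_ge0, cap_ge0).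
have [u0 e0] := (u_gt0, e_gt0); have th0 := th_gt0.
have exp1 x : x <= 0 -> expR (th * x) <= 1.
  by move=> x0; rewrite -expR0 ler_expR pmulr_rle0.
elim: n => [|n IH].
  apply: exp1; rewrite mulr0 subr0 /lyapunov /=.
  have := corrector_le C0 (lexx (0 : R)); lra.
have srt := residual_work_sorted tau sigma n t.
have s0 := sigma_ge0 n t; have t0 := tau_ge0 n.+1 t.
have /andP[w1 _] := weight_bounds n t.
rewrite [residual_work _ _ _ _]/=.
set w := residual_work tau sigma n t in IH srt *.
set L := lyapunov C w in IH *.
set L' := lyapunov C (pos_part _).
case: (leP (sigma n t) K) => sK.
  have hs : 0 <= sigma n t <= K by rewrite s0.
  have := lyapunov_next_drift C0 srt hs t0 c0 C_large.
  rewrite -/L' -/L -/(slope n t) => hL.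
  have {}hL : L' <= Num.max (L + (drift n t - u)) (3 * C + sigma n t).
    apply: le_trans hL _; rewrite le_eqVlt; apply/orP; left; apply/eqP.
    by congr (Num.max _ _); rewrite /drift; ring.
  have hD : (jumps n t)%:R - 1 <= (jumps n.+1 t)%:R :> R.
    rewrite /= /jump sK addn0; case: (jumps n t) => [|m] /=; first by lra.
    by rewrite -natr1; lra.
  have /andP[g0 _] := growth_bounds sK.
  rewrite [weight _ _]/= sK mul1r subrr mul0r addr0.
  move: hL; rewrite le_max => /orP[|] hL.
    apply: (@le_trans _ _ (weight n t * growth n t)); last by rewrite lerDr.
    apply: (@le_trans _ _ (expR (th * (L - (3 * C + K) - u * (jumps n t)%:R))
        * expR (th * drift n t))).
      rewrite -expRD ler_expR -mulrDr ler_pM2l//; nra.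
    by rewrite ler_pM ?expR_ge0// growth_ge_exp.
  apply: (@le_trans _ _ 1); last by rewrite lerDl mulr_ge0//; lra.
  apply: exp1; have : 0 <= u * (jumps n.+1 t)%:R by rewrite mulr_ge0// ltW.
  by lra.
have := lyapunov_next C0 srt s0 t0; rewrite -/L' -/L => hL.
rewrite [weight _ _]/= (leNgt (sigma n t)) sK /= mul0r add0r subr0 mul1r.
have hD : (jumps n t)%:R + sigma n t / u <= (jumps n.+1 t)%:R :> R.
  rewrite /= jumpE// !addnS /= -addnS natrD lerD2l.
  have su : 0 <= sigma n t / u by rewrite divr_ge0// ltW.
  by have /andP[_ /ltW] := truncn_itv su.
have {}hD : u * (jumps n t)%:R + sigma n t <= u * (jumps n.+1 t)%:R.
  rewrite -(ler_pM2l u0) mulrDr in hD.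
  by rewrite (_ : u * (sigma n t / u) = sigma n t) in hD; last by field; rewrite gt_eqF.
move: hL; rewrite le_max => /orP[|] hL.
  apply: le_trans IH; rewrite ler_expR ler_pM2l//; lra.
apply: le_trans w1; apply: exp1.
have : 0 <= u * (jumps n t)%:R by rewrite mulr_ge0// ltW.
by lra.
Qed.

(** The event is split according to the size of the last jump. *)
Lemma jumpsS_tail n t j : (0 < j)%N -> ((j <= jumps n.+1 t)%N%:R : R) =
  \sum_(0 <= k < j.+1) (jump (sigma n t) == k)%:R * (j.+1 - k <= jumps n t)%N%:R
  + (j < jump (sigma n t))%N%:R.
Proof.
move=> j0; rewrite /=; move: (jump _) (jumps n t) => X D.
have -> : (j <= (D + X).-1)%N = (j.+1 <= D + X)%N by nat_lia.
case: (ltnP j X) => jX.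
  rewrite (_ : (j < D + X)%N); last by nat_lia.
  rewrite big_nat big1 ?add0r// => k /andP[_ kj].
  by rewrite (_ : (X == k) = false) ?mul0r//; apply/negbTE; nat_lia.
rewrite addr0 big_mkord (bigD1 (Ordinal (jX : (X < j.+1)%N)))//= eqxx mul1r.
rewrite big1 ?addr0//; last first.
  by move=> k /eqP kX; case: eqP; rewrite ?mul0r// => Xk; case: kX; apply/val_inj.
by congr (_%:R); congr nat_of_bool; nat_lia.
Qed.

End DominatingProcess.

(** * Moments of the dominating process *)

Section Moments.
Context d (T : measurableType d) (R : realType) (P : probability T R).
Context (tau sigma : nat -> {RV P >-> R}).
Context (tau_ge0 : forall n t, 0 <= tau n t).
Context (sigma_ge0 : forall n t, 0 <= sigma n t).
Context (tau_iid : iid tau) (sigma_iid : iid sigma).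
Context (indep : independent_sequences tau sigma).
Context (C K cap u e th : R).
Context (C_gt0 : 0 < C) (K_ge0 : 0 <= K) (cap_ge0 : 0 <= cap) (u_gt0 : 0 < u).
Context (e_gt0 : 0 < e) (th_gt0 : 0 < th).
Context (C_large : K ^+ 2 + cap ^+ 2 <= 2 * C * e).
Context (th_small : th * drift_bound K cap u e <= 1 / 2).

Local Notation past := (past tau sigma).
Local Notation work := (residual_work tau sigma).
Local Notation X := (jump K u).
Local Notation D := (jumps sigma K u).
Local Notation w := (weight tau sigma C K cap u e th).
Local Notation g := (growth tau sigma C K cap u e th).
Local Notation k := (slope tau sigma C).

Definition jump_pmf i : R := 'Ex_P[fun t => (X (sigma 0%N t) == i)%:R].

Definition jump_tail i : R := 'Ex_P[fun t => (i < X (sigma 0%N t))%N%:R].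

Lemma past_measurable_work n : measurable_fun [set: past n] (fun t => (work n t).1)
  /\ measurable_fun [set: past n] (fun t => (work n t).2).
Proof.
elim: n => [|n [IH1 IH2]]; first by split; exact: measurable_cst.
have {}IH1 := past_measurable_funS IH1; have {}IH2 := past_measurable_funS IH2.
have ms : measurable_fun [set: past n.+1] (sigma n) by exact: past_measurable_sigma.
have mt : measurable_fun [set: past n.+1] (tau n.+1) by exact: past_measurable_tau.
have m1 : measurable_fun [set: past n.+1]
    (fun t => (work n t).1 + sigma n t - tau n.+1 t).
  by apply: measurable_funB => //; exact: measurable_funD.
have m2 : measurable_fun [set: past n.+1] (fun t => (work n t).2 - tau n.+1 t).
  exact: measurable_funB.
split; apply: measurable_maxr => //; first exact: measurable_minr.
exact: measurable_maxr.
Qed.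

Lemma past_measurable_slope n : measurable_fun [set: past n] (k n).
Proof.
apply: measurable_funM => //; apply: measurable_maxr => //.
by apply: measurable_funB => //; have [] := past_measurable_work n.
Qed.

Lemma measurable_jump_tail i : measurable_fun setT (fun s : R => (i < X s)%N).
Proof.
rewrite (_ : (fun _ => _) = fun s => (K < s) && ((i < 2)%N || ((i.-2).+1%:R <= s / u))).
  apply: measurable_and; first exact: measurable_fun_ltr.
  apply: measurable_or => //; apply: measurable_fun_ler => //.
  exact: measurable_funM.
apply/funext => s; rewrite /jump; case: leP => //= _.
case: i => [|[|i]] //=.
by rewrite !ltnS -truncn_gt_nat.
Qed.

Lemma measurable_jump_eq i : measurable_fun setT (fun s : R => X s == i).
Proof.
case: i => [|i].
  rewrite (_ : (fun _ => _) = fun s => s <= K); first exact: measurable_fun_ler.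
  by apply/funext => s; rewrite jump_eq0.
rewrite (_ : (fun _ => _) = fun s => (i < X s)%N && ~~ (i.+1 < X s)%N).
  by apply: measurable_and; [|apply: measurable_neg]; exact: measurable_jump_tail.
by apply/funext => s; rewrite -leqNgt -eqn_leq eq_sym.
Qed.

Lemma past_measurable_jumps n j :
  measurable_fun [set: past n] (fun t => (j <= D n t)%N).
Proof.
elim: n j => [|n IH] j; first exact: (measurable_cst (j <= 0)%N).
case: j => [|j]; first by rewrite (_ : (fun _ => _) = cst true).
pose f t := \sum_(0 <= i < j.+2) (X (sigma n t) == i)%:R *
    (j.+2 - i <= D n t)%N%:R + (j.+1 < X (sigma n t))%N%:R : R.
have b2r dd (S : measurableType dd) (b : S -> bool) : measurable_fun setT b ->
    measurable_fun setT (fun t => (b t)%:R : R).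
  by move=> mb; have [] := @bounded_measurable_bool _ S R _ mb.
have ms : measurable_fun [set: past n.+1] (sigma n) by exact: past_measurable_sigma.
have mf : measurable_fun [set: past n.+1] f.
  apply: measurable_funD; last first.
    exact: (measurableT_comp (b2r _ _ _ (measurable_jump_tail j.+1)) ms).
  apply: measurable_sum => i; apply: measurable_funM.
    exact: (measurableT_comp (b2r _ _ _ (measurable_jump_eq i)) ms).
  by apply: past_measurable_funS; apply: b2r; exact: IH.
rewrite (_ : (fun _ => _) = (fun t => 0 < f t)).
  by apply: measurable_fun_ltr.
by apply/funext => t; rewrite /f -jumpsS_tail// ltr0n lt0b.
Qed.

Lemma past_bounded_jumps n j :
  bounded_measurable (fun t : past n => (j <= D n t)%N%:R : R).
Proof. by apply: bounded_measurable_bool; exact: past_measurable_jumps. Qed.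

Lemma past_measurable_growth n : measurable_fun [set: past n.+1] (g n).
Proof.
have ms : measurable_fun [set: past n.+1] (sigma n) by exact: past_measurable_sigma.
have mt : measurable_fun [set: past n.+1] (tau n.+1) by exact: past_measurable_tau.
have mk := past_measurable_funS (past_measurable_slope (n:=n)).
have mm : measurable_fun [set: past n.+1] (fun t => Num.min (tau n.+1 t) cap).
  exact: measurable_minr.
have md : measurable_fun [set: past n.+1] (drift tau sigma C cap u e n).
  apply: measurable_funD => //; apply: measurable_funB.
    apply: measurable_funD => //; apply: measurable_funB => //.
    exact: measurable_funM.
  apply: measurable_funM => //; exact: measurable_funB.
apply: measurable_funD => //; apply: measurable_funD => //.
exact: measurable_funM.
Qed.

Lemma past_measurable_weight n : measurable_fun [set: past n] (w n).
Proof.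
elim: n => [|n IH]; first exact: measurable_cst.
have {}IH := past_measurable_funS IH.
have ms : measurable_fun [set: past n.+1] (sigma n) by exact: past_measurable_sigma.
have mg := past_measurable_growth (n:=n).
have mb : measurable_fun [set: past n.+1] (fun t => (sigma n t <= K)%R%:R : R).
  by have [] := @bounded_measurable_bool _ (past n.+1) R _
    (measurable_fun_ler ms (measurable_cst K)).
apply: measurable_funD.
  apply: measurable_funM => //; apply: measurable_funD => //.
  exact: measurable_funM.
apply: measurable_funM => //; exact: measurable_funB.
Qed.

Lemma past_bounded_weight n : bounded_measurable (w n : past n -> R).
Proof.
apply: bounded_measurable_between (past_measurable_weight (n:=n)) _ => t.
exact: weight_bounds.
Qed.

Lemma past_bounded_slope n : bounded_measurable (k n : past n -> R).
Proof.
apply: bounded_measurable_between (past_measurable_slope (n:=n)) _ => t.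
exact: slope_bounds.
Qed.

Context (a b : R) (le_ab : a <= b).
Context (tau_cap_mean : a - e <= 'Ex_P[fun t => Num.min (tau 0%N t) cap]).
Context (sigma_K_mean : 'Ex_P[fun t => sigma 0%N t * (sigma 0%N t <= K)%R%:R] <= b).
Context (negative_drift : u + 4 * e + 2 * cap * (1 - jump_pmf 0)
  + 2 * th * drift_bound K cap u e ^+ 2 <= 2 * a - b).

Let mK : measurable_fun setT (fun s : R => (s <= K)%R%:R : R).
Proof.
by have [] := @bounded_measurable_bool _ _ R _
  (measurable_fun_ler (@measurable_id _ R setT) (measurable_cst K)).
Qed.

Let bounded_sigma (f : R -> R) M n : measurable_fun setT f ->
  (forall x, 0 <= f x <= M) -> bounded_measurable (f \o sigma n).
Proof.
move=> mf hM; apply: (@bounded_measurable_between _ _ _ _ 0 M) => [|t /=] //.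
exact: measurableT_comp.
Qed.

Let bounded_tau (f : R -> R) M n : measurable_fun setT f ->
  (forall x, 0 <= f x <= M) -> bounded_measurable (f \o tau n).
Proof.
move=> mf hM; apply: (@bounded_measurable_between _ _ _ _ 0 M) => [|t /=] //.
exact: measurableT_comp.
Qed.

Lemma jump_pmf0E : jump_pmf 0 = 'Ex_P[fun t => (sigma 0%N t <= K)%R%:R].
Proof.
by congr (Rintegral _ _ _); apply/funext => t; rewrite -(@jump_eq0 R K u).
Qed.

Lemma jump_pmf0_le1 : 0 <= jump_pmf 0 <= 1.
Proof.
have h01 (x : R) : 0 <= ((x <= K)%R%:R : R) <= 1 by rewrite ler0n lern1 leq_b1.
have h := bounded_sigma 0 mK h01.
rewrite jump_pmf0E Ex_ge0//= -[leRHS](Ex_cst P 1); apply: Ex_le => //.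
- exact: bounded_measurable_cst.
- by move=> t; have /andP[] := h01 (sigma 0%N t).
Qed.

Lemma bounded_growth n :
  bounded_measurable (fun t => (sigma n t <= K)%R%:R * g n t).
Proof.
have mg : measurable_fun setT (g n).
  exact: past_measurable_fun (past_measurable_growth (n:=n)).
apply: (@bounded_measurable_between _ _ _ _ 0 2).
  by apply: measurable_funM => //; exact: (measurableT_comp mK).
move=> t; case: (leP (sigma n t) K) => sK; last by rewrite mul0r lexx ler0n.
by rewrite mul1r; exact: growth_bounds.
Qed.

(** Negative drift, in exponential form.  The mean of the increment is affine in
    the slope [k n], which depends on the past; both extreme values are at most
    [b - 2 a] because [a <= b]. *)
Lemma growth_contracts n (Y : T -> R) :
  bounded_measurable (Y : past n -> R) -> (forall t, 0 <= Y t) ->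
  'Ex_P[fun t => (sigma n t <= K)%R%:R * (Y t * g n t)] <=
  (1 - th * e) * jump_pmf 0 * 'Ex_P[Y].
Proof.
move=> bY Y0.
have [[[C0 K0] c0] [u0 e0]] := (C_gt0, K_ge0, cap_ge0, (u_gt0, e_gt0)).
have th0 := th_gt0.
have bK : bounded_measurable (k n : past n -> R) by exact: past_bounded_slope.
pose f1 (s : R) : R := (s <= K)%R%:R.
pose f2 (s : R) : R := Num.max 0 s * (s <= K)%R%:R.
pose f3 (s : R) : R := Num.max 0 (Num.min s cap).
pose f4 (s : R) : R := 1 - (s <= K)%R%:R.
have f1b s : 0 <= f1 s <= 1 by rewrite /f1 ler0n lern1 leq_b1.
have mf1 : measurable_fun setT f1 by exact: mK.
have bf1 : bounded_measurable (f1 \o sigma n).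
  exact: bounded_sigma f1b.
have f2b s : 0 <= f2 s <= K.
  rewrite /f2; case: (leP s K) => sK; last by rewrite mulr0 lexx K0.
  by rewrite mulr1 le_max lexx ge_max K0 sK.
have mf2 : measurable_fun setT f2.
  by apply: measurable_funM => //; apply: measurable_maxr.
have bf2 : bounded_measurable (f2 \o sigma n).
  exact: bounded_sigma f2b.
have f3b s : 0 <= f3 s <= cap.
  by rewrite /f3 le_max lexx ge_max c0 ge_min lexx orbT.
have mf3 : measurable_fun setT f3.
  by apply: measurable_maxr => //; apply: measurable_minr.
have bf3 : bounded_measurable (f3 \o tau n.+1).
  exact: bounded_tau f3b.
have f4b s : 0 <= f4 s <= 1.
  by rewrite /f4; have := f1b s; rewrite /f1 => /andP[h1 h2]; apply/andP; split; lra.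
have mf4 : measurable_fun setT f4 by apply: measurable_funB.
have bf4 : bounded_measurable (f4 \o sigma n).
  exact: bounded_sigma f4b.
pose Y1 t := Y t * (1 - k n t).
pose Y2 t := Y t + Y1 t.
have bY1 : bounded_measurable (Y1 : past n -> R).
  apply: bounded_measurableM => //; apply: bounded_measurableD.
    exact: bounded_measurable_cst.
  exact: bounded_measurableN.
have Y10 t : 0 <= Y1 t.
  by rewrite mulr_ge0// subr_ge0; have /andP[] := slope_bounds tau sigma C_gt0 n t.
have Y1Y t : Y1 t <= Y t.
  by rewrite ler_piMr// gerBl; have /andP[] := slope_bounds tau sigma C_gt0 n t.
have bY2 : bounded_measurable (Y2 : past n -> R) by exact: bounded_measurableD.
have Y20 t : 0 <= Y2 t by exact: addr_ge0.
have bY' := past_bounded_measurable bY.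
have bY1' := past_bounded_measurable bY1.
have bY2' := past_bounded_measurable bY2.
pose c1 := 1 + th * (u + e) + 2 * (th * drift_bound K cap u e) ^+ 2.
(* Each term of F is a past variable times a function of one new variable.
   To get there, the indicator of a short service time is dropped from the term
   with the interarrival time; this costs at most 2 * cap on long ones. *)
pose F t := c1 * (Y t * f1 (sigma n t)) + (th * (Y1 t * f2 (sigma n t))
  + (- th * (Y2 t * f3 (tau n.+1 t)) + 2 * cap * th * (Y t * f4 (sigma n t)))).
have bm1 := bounded_measurableM bY' bf1.
have bm2 := bounded_measurableM bY1' bf2.
have bm3 := bounded_measurableM bY2' bf3.
have bm4 := bounded_measurableM bY' bf4.
have bZ (c : R) (f : T -> R) : bounded_measurable f ->
    bounded_measurable (fun t => c * f t).
  by move=> bf; apply: bounded_measurableM => //; exact: bounded_measurable_cst.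
have b34 := bounded_measurableD (bZ (- th) _ bm3) (bZ (2 * cap * th) _ bm4).
have b234 := bounded_measurableD (bZ th _ bm2) b34.
have b1234 := bounded_measurableD (bZ c1 _ bm1) b234.
have le_F t : (sigma n t <= K)%R%:R * (Y t * g n t) <= F t.
  rewrite /F /f1 /f2 /f3 /f4 /growth /drift /c1 /Y2 /Y1.
  have s0 := sigma_ge0 n t; have t0 := tau_ge0 n.+1 t.
  rewrite [Num.max 0 (sigma n t)]max_r//.
  rewrite [Num.max 0 (Num.min _ _)]max_r; last by rewrite le_min t0 c0.
  have : 0 <= Num.min (tau n.+1 t) cap <= cap.
    by rewrite le_min t0 c0 ge_min lexx orbT.
  have /andP[k0 k1] := slope_bounds tau sigma C_gt0 n t.
  move: (Num.min _ _) (k n t) k0 k1 (Y t) (Y0 t) => t' kk k0 k1 y y0 /andP[t'0 t'c].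
  move: (sigma n t) s0 => s s0.
  case: (leP s K) => sK; rewrite /= ?mulr1 ?mulr0 ?mul1r ?mul0r.
    rewrite le_eqVlt; apply/orP; left; apply/eqP; rewrite /drift_bound; ring.
  have h1 : 0 <= (2 - kk) * t' <= 2 * cap by apply/andP; split; nra.
  have h2 : 0 <= th * y by rewrite mulr_ge0// ltW.
  have := h1 => /andP[h3 h4].
  have h5 : th * y * ((2 - kk) * t') <= th * y * (2 * cap) by rewrite ler_wpM2l.
  lra.
apply: (@le_trans _ _ ('Ex_P[F])).
  apply: Ex_le => //.
  rewrite (_ : (fun _ => _) = fun t => Y t * ((sigma n t <= K)%R%:R * g n t)).
    by apply: bounded_measurableM => //; exact: bounded_growth.
  by apply/funext => t; ring.
rewrite /F ExD//; last exact: bZ.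
rewrite ExD//; last exact: bZ.
rewrite ExD//; [|exact: bZ|exact: bZ].
rewrite !ExZ//.
have pos (f : R -> R) (M : R) : (forall x, 0 <= f x <= M) ->
    forall x : R, (0 : R) <= f x.
  by move=> h x; have /andP[] := h x.
rewrite (Ex_past_sigma sigma_iid indep bY Y0 mf1 (pos _ _ f1b) bf1).
rewrite (Ex_past_sigma sigma_iid indep bY1 Y10 mf2 (pos _ _ f2b) bf2).
rewrite (Ex_past_sigma sigma_iid indep bY Y0 mf4 (pos _ _ f4b) bf4).
rewrite (Ex_past_tau tau_iid indep bY2 Y20 mf3 (pos _ _ f3b) bf3).
rewrite (ExD P bY' bY1').
have E1 : 'Ex_P[f1 \o sigma 0%N] = jump_pmf 0 by rewrite jump_pmf0E.
have E4 : 'Ex_P[f4 \o sigma 0%N] = 1 - jump_pmf 0.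
  rewrite (_ : f4 \o _ = fun t => 1 + -1 * (f1 \o sigma 0%N) t); last first.
    by apply/funext => t; rewrite /f4 /f1 /=; ring.
  have b1 := bounded_sigma 0 mf1 f1b.
  rewrite ExD; [|exact: bounded_measurable_cst|exact: bZ].
  by rewrite Ex_cst ExZ// E1; ring.
have E2 : 'Ex_P[f2 \o sigma 0%N] <= b.
  rewrite (_ : f2 \o _ = fun t => sigma 0%N t * (sigma 0%N t <= K)%R%:R)//.
  by apply/funext => t /=; rewrite /f2 max_r.
have E3 : a - e <= 'Ex_P[f3 \o tau 0%N].
  rewrite (_ : f3 \o _ = fun t => Num.min (tau 0%N t) cap)//.
  by apply/funext => t /=; rewrite /f3 max_r// le_min tau_ge0.
have y0 : 0 <= 'Ex_P[Y] by exact: Ex_ge0.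
have y10 : 0 <= 'Ex_P[Y1] by exact: Ex_ge0.
have y1y : 'Ex_P[Y1] <= 'Ex_P[Y] by exact: Ex_le.
have /andP[p0 p1] := jump_pmf0_le1.
rewrite E1 E4; have nd := negative_drift; have ab := le_ab; rewrite /c1.
move: ('Ex_P[Y]) ('Ex_P[Y1]) ('Ex_P[f2 \o _]) ('Ex_P[f3 \o _]) (jump_pmf 0)
  E2 E3 y0 y10 y1y p0 p1 nd => y y1 b1 a1 p E2 E3 y0 y10 y1y p0 p1 nd {E1 E4}.
move: (drift_bound K cap u e) nd => B nd.
have h1 : y1 * b1 - (y + y1) * a1 <= y * (b - 2 * a + 2 * e) by nra.
have z0 : 0 <= th * B ^+ 2 by rewrite mulr_ge0 ?sqr_ge0// ltW.
have h2 : p * (u + e) + 2 * p * (th * B ^+ 2) + (b - 2 * a + 2 * e)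
          + 2 * cap * (1 - p) + p * e <= 0.
  rewrite -(mulrA 2 th) in nd; move: (th * B ^+ 2) z0 nd => z z0 nd.
  have : p * (u + 2 * e) <= u + 2 * e by rewrite ler_piMl// addr_ge0//; lra.
  have : p * z <= z by rewrite ler_piMl.
  by lra.
rewrite -subr_le0.
rewrite (_ : _ - _ = th * (y * (p * (u + e) + 2 * p * (th * B ^+ 2)
  + (b - 2 * a + 2 * e) + 2 * cap * (1 - p) + p * e))
  + th * (y1 * b1 - (y + y1) * a1 - y * (b - 2 * a + 2 * e))); last by ring.
rewrite -mulrDr pmulr_rle0//.
have : y * (p * (u + e) + 2 * p * (th * B ^+ 2)
  + (b - 2 * a + 2 * e) + 2 * cap * (1 - p) + p * e) <= 0 by rewrite mulr_ge0_le0.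
by lra.
Qed.


Context (r : nat -> R) (r0 : r 0%N = 1) (r_ge0 : forall j, 0 <= r j).
Context (r_super : forall j, (0 < j)%N ->
  \sum_(0 <= i < j.+1) jump_pmf i * r (j.+1 - i)%N + jump_tail j <= r j).

Let bool01 (c : bool) : 0 <= (c%:R : R) <= 1.
Proof. by rewrite ler0n lern1 leq_b1. Qed.

Let mbool (c : R -> bool) : measurable_fun setT c ->
  measurable_fun setT (fun s => (c s)%:R : R).
Proof. by move=> mb; have [] := @bounded_measurable_bool _ _ R _ mb. Qed.

Let Ex_sigma_bool n (Y : T -> R) (c : R -> bool) :
  bounded_measurable (Y : past n -> R) -> (forall t, 0 <= Y t) ->
  measurable_fun setT c ->
  bounded_measurable (fun t => Y t * (c (sigma n t))%:R) /\
  'Ex_P[fun t => Y t * (c (sigma n t))%:R] =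
  'Ex_P[Y] * 'Ex_P[fun t => (c (sigma 0%N t))%:R].
Proof.
move=> bY Y0 mb.
have bb := bounded_sigma n (mbool mb) (fun x => bool01 (c x)).
split; first exact: bounded_measurableM (past_bounded_measurable bY) bb.
by apply: (Ex_past_sigma sigma_iid indep bY Y0 (mbool mb) _ bb) => x; rewrite ler0n.
Qed.

Lemma jump_pmf0_tail0 : jump_pmf 0 + jump_tail 0 = 1.
Proof.
rewrite /jump_pmf /jump_tail -ExD; last 2 first.
- exact: (bounded_sigma 0 (mbool (measurable_jump_eq 0)) (fun x => bool01 _)).
- exact: (bounded_sigma 0 (mbool (measurable_jump_tail 0)) (fun x => bool01 _)).
rewrite -[RHS](Ex_cst P 1); congr (Rintegral _ _ _); apply/funext => t.
by case: (X _) => [|m] /=; rewrite ?addr0 ?add0r.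
Qed.

Lemma jump_tailS i : jump_tail i = jump_pmf i.+1 + jump_tail i.+1.
Proof.
rewrite /jump_pmf /jump_tail -ExD; last 2 first.
- exact: (bounded_sigma 0 (mbool (measurable_jump_eq i.+1)) (fun x => bool01 _)).
- exact: (bounded_sigma 0 (mbool (measurable_jump_tail i.+1)) (fun x => bool01 _)).
congr (Rintegral _ _ _); apply/funext => t.
by case: (ltngtP (X (sigma 0%N t)) i.+1) => h; rewrite ?addr0 ?add0r ?ltnS;
  case: (ltnP i (X (sigma 0%N t))) => //; nat_lia.
Qed.

Let Yone n : bounded_measurable (fun _ : past n => 1 : R).
Proof. exact: bounded_measurable_cst. Qed.

(** Induction on [n]: the hypothesis on [r] says that [r] is preserved by the
    transition of the chain, up to an inequality. *)
Lemma jumps_tail_le n j : 'Ex_P[fun t => (j <= D n t)%N%:R] <= r j.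
Proof.
elim: n j => [|n IH] j.
  case: j => [|j] /=; rewrite ?r0 Ex_cst//.
case: j => [|j]; first by rewrite /= Ex_cst r0.
apply: le_trans (r_super (ltn0Sn j)).
pose F i t : R := (j.+2 - i <= D n t)%N%:R * (X (sigma n t) == i)%:R.
have hF i := Ex_sigma_bool (past_bounded_jumps n (j.+2 - i))
  (fun t => ler0n _ _) (measurable_jump_eq i).
have [b1 e1] := Ex_sigma_bool (Yone n) (fun t => ler01) (measurable_jump_tail j.+1).
rewrite [X in Rintegral _ _ X](_ : _ = fun t => \sum_(0 <= i < j.+2) F i t
    + 1 * (j.+1 < X (sigma n t))%N%:R); last first.
  apply/funext => t; rewrite jumpsS_tail// mul1r; congr (_ + _).
  by apply: eq_bigr => i _; rewrite mulrC.
have bF i : bounded_measurable (F i) by have [] := hF i.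
rewrite ExD//; last exact: bounded_measurable_sum.
rewrite Ex_sum// e1 Ex_cst mul1r lerD2r ler_sum// => i _.
have [_ ->] := hF i.
by rewrite mulrC ler_wpM2l//; apply: Ex_ge0 => t; exact: ler0n.
Qed.

Let weight_tail n j t : R := w n t * (j <= D n t)%N%:R.

Let bounded_weight_tail n j : bounded_measurable (weight_tail n j : past n -> R).
Proof.
apply: bounded_measurableM; first exact: past_bounded_weight.
exact: past_bounded_jumps.
Qed.

Let weight_tail_ge0 n j t : 0 <= weight_tail n j t.
Proof.
rewrite mulr_ge0 ?ler0n//.
have := weight_bounds tau_ge0 sigma_ge0 C_gt0 K_ge0 cap_ge0 u_gt0 e_gt0 th_gt0
  th_small n t.
by move=> /andP[/(le_trans ler01)].
Qed.

(** The factor [1 / (th e)] is the fixed point of [x |-> 1 + (1 - th e) x], which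
    is how the mean weight evolves over a short service time. *)
Lemma weight_tail_small_jump n j :
  'Ex_P[weight_tail n j] <= r j / (th * e) ->
  'Ex_P[fun t => (sigma n t <= K)%R%:R * ((1 + w n t * g n t) * (j <= D n t)%N%:R)]
  <= jump_pmf 0 * (r j / (th * e)).
Proof.
move=> IH; have the : 0 < th * e by rewrite mulr_gt0.
have hb := Ex_sigma_bool (past_bounded_jumps n j) (fun t => ler0n _ _)
  (measurable_jump_eq 0).
have hg := growth_contracts (bounded_weight_tail n j) (weight_tail_ge0 n j).
pose F1 t : R := (j <= D n t)%N%:R * (X (sigma n t) == 0)%N%:R.
pose F2 t : R := (sigma n t <= K)%R%:R * (weight_tail n j t * g n t).
rewrite [X in Rintegral _ _ X](_ : _ = fun t => F1 t + F2 t); last first.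
  by apply/funext => t; rewrite /F1 /F2 /weight_tail jump_eq0; ring.
rewrite ExD; last 2 first.
- by case: hb.
- rewrite (_ : F2 = fun t => weight_tail n j t * ((sigma n t <= K)%R%:R * g n t)).
    apply: bounded_measurableM; last exact: bounded_growth.
    exact: past_bounded_measurable (bounded_weight_tail n j).
  by apply/funext => t; rewrite /F2; ring.
have [_ ->] := hb.
have /andP[p0 p1] := jump_pmf0_le1.
apply: (@le_trans _ _ (r j * jump_pmf 0 +
    (1 - th * e) * jump_pmf 0 * (r j / (th * e)))).
  apply: lerD.
    by rewrite ler_wpM2r// jumps_tail_le.
  apply: (le_trans hg); rewrite ler_wpM2l// mulr_ge0// subr_ge0.
  have h := th_small; have [[[K0 c0] u0] e0] := (K_ge0, cap_ge0, u_gt0, e_gt0).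
  have th0 := th_gt0; rewrite /drift_bound in h.
  have : 0 <= th * (K + 2 * cap + u) by rewrite mulr_ge0//; lra.
  by lra.
rewrite le_eqVlt; apply/orP; left; apply/eqP; field.
by rewrite !gt_eqF.
Qed.

(** Same induction as [jumps_tail_le]: a long service time leaves the weight
    unchanged and moves the chain, a short one is handled by
    [weight_tail_small_jump]. *)
Lemma weight_tail_le n j : 'Ex_P[fun t => w n t * (j <= D n t)%N%:R] <= r j / (th * e).
Proof.
have the : 0 < th * e by rewrite mulr_gt0.
have the1 : th * e <= 1.
  have h := th_small; have [[[K0 c0] u0] e0] := (K_ge0, cap_ge0, u_gt0, e_gt0).
  have th0 := th_gt0; rewrite /drift_bound in h.
  have : 0 <= th * (K + 2 * cap + u) by rewrite mulr_ge0//; lra.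
  by lra.
rewrite -/(weight_tail n j).
elim: n j => [|n IH] j.
  rewrite /weight_tail; case: j => [|j] /=.
    by rewrite Ex_cst r0 mulr1 ler_pdivlMr// mul1r.
  by rewrite mulr0 Ex_cst divr_ge0// ltW.
have IHs j' := weight_tail_small_jump (IH j').
pose F0 j' t : R := (sigma n t <= K)%R%:R * ((1 + w n t * g n t) * (j' <= D n t)%N%:R).
have bF0 j' : bounded_measurable (F0 j').
  rewrite (_ : F0 j' = fun t => (j' <= D n t)%N%:R *
      ((sigma n t <= K)%R%:R + w n t * ((sigma n t <= K)%R%:R * g n t))).
    apply: bounded_measurableM.
      exact: past_bounded_measurable (past_bounded_jumps n j').
    apply: bounded_measurableD; first exact: bounded_sigma mK (fun x => bool01 _).
    apply: bounded_measurableM; last exact: bounded_growth.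
    exact: past_bounded_measurable (past_bounded_weight n).
  by apply/funext => t; rewrite /F0; ring.
have bw := past_bounded_weight n.
have w_ge0 t : 0 <= w n t by have := weight_tail_ge0 n 0 t; rewrite /weight_tail mulr1.
case: j => [|j].
  have [b1 e1] := Ex_sigma_bool bw w_ge0 (measurable_jump_tail 0).
  rewrite [X in Rintegral _ _ X](_ : _ = fun t => F0 0%N t
      + w n t * (0 < X (sigma n t))%N%:R); last first.
    apply/funext => t; rewrite /weight_tail /F0 /= !mulr1 lt0n jump_eq0.
    by case: (leP _ K) => _ /=; ring.
  rewrite ExD// e1 r0.
  have := IHs 0%N; rewrite r0.
  have := IH 0%N; rewrite r0 [X in Rintegral _ _ X](_ : _ = w n); last first.
    by apply/funext => t; rewrite /weight_tail mulr1.
  have p1 := jump_pmf0_tail0.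
  have -> : 'Ex_P[fun t => (0 < X (sigma 0%N t))%N%:R] = 1 - jump_pmf 0.
    by apply/eqP; rewrite eq_sym subr_eq -{1}p1 addrC.
  have /andP[p0 p1'] := jump_pmf0_le1.
  move=> h1 h2; apply: (@le_trans _ _ (jump_pmf 0 * (1 / (th * e)) +
      1 / (th * e) * (1 - jump_pmf 0))).
    by rewrite lerD// ler_wpM2r// subr_ge0.
  by rewrite le_eqVlt; apply/orP; left; apply/eqP; ring.
pose F i t : R := weight_tail n (j.+2 - i) t * (X (sigma n t) == i)%:R.
have hF i := Ex_sigma_bool (bounded_weight_tail n (j.+2 - i))
  (weight_tail_ge0 n (j.+2 - i)) (measurable_jump_eq i).
have bF i : bounded_measurable (F i) by have [] := hF i.
have [b1 e1] := Ex_sigma_bool bw w_ge0 (measurable_jump_tail j.+1).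
rewrite [X in Rintegral _ _ X](_ : _ = fun t => F0 j.+2 t +
    (\sum_(1 <= i < j.+2) F i t + w n t * (j.+1 < X (sigma n t))%N%:R)); last first.
  apply/funext => t; rewrite /weight_tail; case: (leP (sigma n t) K) => sK.
    have X0 : X (sigma n t) = 0%N by apply/eqP; rewrite jump_eq0.
    rewrite /F0 /F /= X0 sK addn0 big_nat big1 => [|i /andP[i0 _]]; last first.
      by rewrite (ltn_eqF i0) mulr0.
    rewrite (_ : (j < (D n t).-1)%N = (j.+2 <= D n t)%N) /=; first by ring.
    by case: (D n t).
  rewrite jumpsS_tail// big_ltn//.
  have /negbTE X0 : X (sigma n t) != 0%N by rewrite jump_eq0 -ltNge.
  rewrite X0 mul0r add0r /F0 /= (leNgt (sigma n t)) sK /= !mul0r !add0r subr0 mul1r.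
  rewrite mulrDr mulr_sumr; congr (_ + _); apply: eq_bigr => i _.
  by rewrite /F /weight_tail; ring.
have bS := bounded_measurable_sum (index_iota 1 j.+2) bF.
rewrite ExD//; last exact: bounded_measurableD.
rewrite ExD// Ex_sum// e1.
have c0 : 0 <= (th * e)^-1 by rewrite invr_ge0 ltW.
have hw : 'Ex_P[w n] <= (th * e)^-1.
  rewrite -[leRHS]mul1r -r0; apply: le_trans (IH 0%N).
  rewrite le_eqVlt; apply/orP; left; apply/eqP; congr (Rintegral _ _ _).
  by apply/funext => t; rewrite /weight_tail mulr1.
apply: (@le_trans _ _ ((\sum_(0 <= i < j.+2) jump_pmf i * r (j.+2 - i)%N
    + jump_tail j.+1) / (th * e))); last first.
  by rewrite ler_wpM2r// r_super.
rewrite [leRHS]mulrDl [in leRHS]big_ltn// [in leRHS]mulrDl -addrA lerD//.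
  by rewrite -mulrA; exact: IHs.
rewrite lerD//; last first.
  rewrite mulrC ler_wpM2l//; apply: Ex_ge0 => t; exact: ler0n.
rewrite mulr_suml ler_sum// => i _; have [_ ->] := hF i.
rewrite -mulrA mulrC ler_wpM2l//; apply: Ex_ge0 => t; exact: ler0n.
Qed.


(** If twice the smaller work exceeds [y], then [jumps] is at least [N - L] or,
    for [j = jumps], the weight is at least [exp (th u (N - j))]; Markov's
    inequality for each [j]. *)
Lemma work_tail_le n N L y : 3 * C + K + u * N%:R <= y ->
  fine (P [set t | y <= 2 * (work n t).1]) <= r (N - L)%N +
    \sum_(0 <= j < N - L) expR (- (th * u)) ^+ (N - j) * (r j / (th * e)).
Proof.
move=> hy; have [u0 th0] := (u_gt0, th_gt0).
have C0 := C_gt0.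
have mW : measurable_fun setT (fun t => y <= 2 * (work n t).1).
  apply: measurable_fun_ler => //; apply: measurable_funM => //.
  exact: past_measurable_fun (past_measurable_work n).1.
rewrite -Ex_bool//.
pose s := expR (- (th * u)).
have s0 : 0 <= s by exact: expR_ge0.
pose F j t : R := s ^+ (N - j) * (w n t * (j <= D n t)%N%:R).
have bwt j := past_bounded_measurable (bounded_weight_tail n j).
have bF j : bounded_measurable (F j).
  by apply: bounded_measurableM; [exact: bounded_measurable_cst|exact: bwt].
have bD := past_bounded_measurable (past_bounded_jumps n (N - L)).
have bS := bounded_measurable_sum (index_iota 0 (N - L)) bF.
apply: (@le_trans _ _ ('Ex_P[fun t => (N - L <= D n t)%N%:R +
    \sum_(0 <= j < N - L) F j t])).
  apply: Ex_le; [exact: bounded_measurable_bool|exact: bounded_measurableD|move=> t].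
  have F_ge0 j : 0 <= F j t by rewrite mulr_ge0 ?exprn_ge0//; exact: weight_tail_ge0.
  case: (leP y) => [yW|_]; last by rewrite addr_ge0 ?ler0n ?sumr_ge0.
  case: (leqP (N - L) (D n t)) => DN.
    by rewrite lerDl sumr_ge0.
  rewrite add0r big_mkord (bigD1 (Ordinal DN))//=.
  suff h : 1 <= F (D n t) t by rewrite (le_trans h)// lerDl sumr_ge0.
  rewrite /F leqnn mulr1.
  have := weight_dominates tau_ge0 sigma_ge0 C_gt0 K_ge0 cap_ge0 u_gt0 e_gt0
    th_gt0 C_large th_small n t.
  have /andP[w0 w12] := residual_work_sorted tau sigma n t.
  have c0 := corrector_ge0 C0 (work n t).1.
  set Lw := lyapunov C _ => hw.
  have hL : y <= Lw by rewrite /Lw /lyapunov; lra.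
  have DN' : (D n t <= N)%N by nat_lia.
  apply: (@le_trans _ _ (s ^+ (N - D n t) *
     expR (th * (Lw - (3 * C + K) - u * (D n t)%:R)))); last first.
    by rewrite ler_wpM2l// exprn_ge0.
  apply: (@le_trans _ _ (expR 0)); first by rewrite expR0.
  rewrite /s -expRM_natl -expRD ler_expR natrB//.
  have -> : (N%:R - (D n t)%:R) * - (th * u) + th * (Lw - (3 * C + K) - u * (D n t)%:R)
    = th * (Lw - (3 * C + K + u * N%:R)) by ring.
  by rewrite mulr_ge0//; lra.
rewrite ExD// lerD//; first exact: jumps_tail_le.
rewrite Ex_sum// ler_sum// => j _.
rewrite /F ExZ; last exact: bwt.
by rewrite ler_wpM2l ?exprn_ge0// weight_tail_le.
Qed.

End Moments.

(** * The renewal equation and the mean excess *)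

Lemma strong_recursion (T : Type) (G : seq T -> T) :
  exists f : nat -> T, forall n, f n = G (mkseq f n).
Proof.
pose S := fix S n := if n is m.+1 then rcons (S m) (G (S m)) else [::].
exists (fun n => G (S n)) => n; congr G.
elim: n => [//|n IH] /=.
by rewrite mkseqS -IH.
Qed.

Section RenewalSolution.
Context (R : realType) (q H p : nat -> R).
Context (q_ge0 : forall i, 0 <= q i) (q0_lt1 : q 0%N < 1) (H_ge0 : forall i, 0 <= H i).

(** The term [q 0 * r j] on the right makes the equation implicit in [r j]; it is
    solved for since [q 0 < 1]. *)
Lemma renewal_solution : exists r : nat -> R,
  [/\ r 0%N = 1, forall j, 0 <= r j & forall j, (0 < j)%N ->
    r j = H j + \sum_(0 <= i < j) q i * r (j - i)%N].
Proof.
pose G (s : seq R) : R := if size s == 0%N then 1 else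
  (H (size s) + \sum_(1 <= i < size s) q i * nth 0 s (size s - i)%N) / (1 - q 0%N).
have [r rE] := strong_recursion G.
have q1 : 0 < 1 - q 0%N by rewrite subr_gt0.
have r0 : r 0%N = 1 by rewrite rE /G.
have rS j : (0 < j)%N -> r j * (1 - q 0%N) =
    H j + \sum_(1 <= i < j) q i * r (j - i)%N.
  move=> j0; rewrite rE /G size_mkseq gtn_eqF// divfK ?gt_eqF//; congr (_ + _).
  rewrite big_nat [RHS]big_nat; apply: eq_bigr => i /andP[i1 ij].
  by rewrite nth_mkseq//; nat_lia.
exists r; split => //.
  elim/ltn_ind => -[|j] IH; first by rewrite r0 ler01.
  rewrite -(pmulr_lge0 _ q1) rS// addr_ge0// big_nat sumr_ge0// => i /andP[i1 ij].
  by rewrite mulr_ge0// IH//; nat_lia.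
move=> j j0; rewrite big_ltn// subn0.
transitivity (q 0%N * r j + r j * (1 - q 0%N)); first by ring.
by rewrite rS//; ring.
Qed.

(** Tail form and one-step form of the stationarity of the chain that jumps by
    [i] with probability [p i] and then goes down by one: the second is the
    difference of two consecutive instances of the first. *)
Lemma renewal_solution_super r : (forall j, (0 < j)%N ->
    r j = H j + \sum_(0 <= i < j) q i * r (j - i)%N) ->
  p 0%N + q 0%N = 1 -> (forall i, q i = p i.+1 + q i.+1) ->
  (forall j, H j = q j + H j.+1) ->
  forall j, (0 < j)%N -> \sum_(0 <= i < j.+1) p i * r (j.+1 - i)%N + q j <= r j.
Proof.
move=> rE p0 pS HS j j0.
have p0E : p 0%N = 1 - q 0%N by rewrite -p0 addrK.
have rj := rE j j0; have rj1 := rE j.+1 isT.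
have split_sum (f : nat -> R) : \sum_(0 <= i < j.+1) f i * r (j.+1 - i)%N =
    f 0%N * r j.+1 + \sum_(0 <= i < j) f i.+1 * r (j - i)%N.
  by rewrite big_nat_recl//= subn0.
rewrite split_sum in rj1; rewrite split_sum p0E.
have -> : \sum_(0 <= i < j) p i.+1 * r (j - i)%N =
    \sum_(0 <= i < j) q i * r (j - i)%N - \sum_(0 <= i < j) q i.+1 * r (j - i)%N.
  rewrite -sumrB; apply: eq_bigr => i _; rewrite (pS i); ring.
have -> : \sum_(0 <= i < j) q i.+1 * r (j - i)%N = r j.+1 - H j.+1 - q 0%N * r j.+1.
  by rewrite {1}rj1; ring.
have -> : \sum_(0 <= i < j) q i * r (j - i)%N = r j - H j by rewrite {1}rj; ring.
rewrite (HS j).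
rewrite le_eqVlt; apply/orP; left; apply/eqP; ring.
Qed.

End RenewalSolution.

Section Excess.
Context d (T : measurableType d) (R : realType) (P : probability T R).
Context (X : {RV P >-> R}) (X_ge0 : forall t, 0 <= X t).
Context (mean : R) (X_mean : ('E_P[X] = mean%:E)%E).

(** This is the integral of the tail of [X] over the half-line beyond [x]
    ([layer_cake]). *)
Definition excess (x : R) : R := 'Ex_P[fun t => Num.max 0 (X t - x)].

Lemma integrable_mean : P.-integrable setT (EFin \o X).
Proof.
apply/integrableP; split; first by apply/measurable_EFinP.
rewrite (eq_integral (EFin \o X)); last first.
  by move=> t _ /=; rewrite ger0_norm.
by have := X_mean; rewrite expectation_def => ->; rewrite ltry.
Qed.

Lemma Ex_mean : 'Ex_P[X] = mean.
Proof. by rewrite /Rintegral; have := X_mean; rewrite expectation_def => ->. Qed.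

Lemma integrable_excess x : 0 <= x ->
  P.-integrable setT (EFin \o (fun t => Num.max 0 (X t - x))).
Proof.
move=> x0; apply: le_integrable integrable_mean => //.
  by apply/measurable_EFinP; apply: measurable_maxr => //; apply: measurable_funB.
move=> t _ /=; rewrite lee_fin ger0_norm ?le_max ?lexx// ger0_norm// ge_max X_ge0/=.
by rewrite gerBl.
Qed.

Lemma excess_nincr x y : 0 <= x -> x <= y -> excess y <= excess x.
Proof.
move=> x0 xy; apply: le_Rintegral => //.
- exact/integrable_excess/(le_trans x0).
- exact: integrable_excess.
move=> t _; rewrite ge_max le_max lexx/= le_max; apply/orP; right; lra.
Qed.

(** Dominated convergence. *)
Lemma excess_cvg0 (eps : R) : 0 < eps ->
  exists2 x0 : R, 0 < x0 & forall x : R, x0 <= x -> excess x <= eps.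
Proof.
move=> eps0.
have mX : measurable_fun setT (X : T -> R) by [].
have h : (\int[P]_t (Num.max 0 (X t - n%:R))%:E)%E @[n --> \oo] -->
    (\int[P]_t (cst 0%E t))%E.
  apply: (@dominated_cvg _ _ _ P setT measurableT
    (fun n t => (Num.max 0 (X t - n%:R))%:E) (cst 0%E) (EFin \o X)).
  - move=> n; apply/measurable_EFinP; apply: measurable_maxr => //.
    exact: measurable_funB.
  - move=> t _; apply: cvg_near_cst; near=> n.
    congr (_%:E); rewrite max_l// subr_le0.
    by near: n; exact: nbhs_infty_ger.
  - by [].
  - exact: integrable_mean.
  - move=> n t _ /=; rewrite lee_fin ger0_norm ?le_max ?lexx//.
    by rewrite ge_max X_ge0 gerBl ler0n.
rewrite integral_cst// mul0e in h.
move: h => /fine_cvgP[_ /cvgrPdist_le /(_ _ eps0)[n _ hn]].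
have := hn n.+1 (leqnSn n); rewrite /= sub0r normrN => hn1.
exists n.+1%:R; first by rewrite ltr0n.
move=> x nx; apply: (le_trans (excess_nincr _ nx)); first exact: ler0n.
exact: le_trans (ler_norm _) hn1.
Unshelve. all: by end_near.
Qed.

Lemma Ex_min_cap x : 0 <= x -> 'Ex_P[fun t => Num.min (X t) x] = mean - excess x.
Proof.
move=> x0; rewrite -Ex_mean /excess -RintegralB//; last 2 first.
- exact: integrable_mean.
- exact: integrable_excess.
congr (Rintegral _ _ _); apply/funext => t.
have h (y : R) : Num.min y x = y - Num.max 0 (y - x).
  by case: (leP y x) => h; [rewrite max_l|rewrite max_r]; lra.
exact: h.
Qed.

(** Tonelli: [(X t - x)^+] is the length of the interval from [x] to [X t]. *)
Lemma layer_cake x : 0 < x ->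
  (\int[lebesgue_measure]_(y in `]x, +oo[) tail (distribution P X) y =
   (excess x)%:E)%E.
Proof.
move=> x0; rewrite /excess /Rintegral fineK; last first.
  by apply: integrable_fin_num => //; apply: integrable_excess; exact: ltW.
pose GR := measurableTypeR R.
pose mu : {measure set GR -> \bar R} := @lebesgue_measure R.
(* The indicator of the region below the graph of X and above x. *)
pose f (p : T * GR) : \bar R := (\1_`]x, X p.1[ p.2)%:E.
have mf : measurable_fun setT f.
  apply/measurable_EFinP/measurable_indic => /=.
  rewrite [X in measurable X](_ : _ = [set p : T * GR | (x < p.2) && (p.2 < X p.1)]).
    have mb : measurable_fun setT (fun p : T * GR => (x < p.2) && (p.2 < X p.1)).
      apply: measurable_and; apply: measurable_fun_ltr => //.
      exact: measurableT_comp.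
    by have := mb measurableT [set true] Logic.I; rewrite setTI.
  by apply/seteqP; split => p /=; rewrite in_itv/=.
have f0 p : (0 <= f p)%E by rewrite lee_fin.
transitivity (\int[P]_t \int[mu]_y f (t, y))%E; last first.
  apply: eq_integral => t _; rewrite /f/= integral_indic//.
  rewrite setIT; transitivity (lebesgue_measure [set` `]x, X t[]); first by [].
  rewrite lebesgue_measure_itv/= lte_fin.
  case: ltP => h; first by rewrite max_r -?EFinB// subr_ge0 ltW.
  by rewrite max_l// subr_le0.
rewrite (fubini_tonelli f)//= integral_mkcond.
apply: eq_integral => y _; rewrite patchE /f /=.
case: ifPn => [|]; rewrite ?notin_setE ?inE /= in_itv/= andbT => xy.
  rewrite (eq_integral (fun t => (\1_[set t | y < X t] t)%:E)); last first.
    move=> t _; congr (_%:E); rewrite !indicE; congr (_%:R); congr nat_of_bool.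
    by apply/idP/idP; rewrite !inE/= in_itv/= xy.
  rewrite integral_indic// ?setIT; last first.
    have mb : measurable_fun setT (fun t => y < X t) by exact: measurable_fun_ltr.
    by have := mb measurableT [set true] Logic.I; rewrite setTI.
  rewrite /tail /distribution /pushforward; congr (P _).
  by apply/seteqP; split => t /=; rewrite in_itv/= andbT.
rewrite integral0_eq// => t _; rewrite indicE memNset//= in_itv/=.
by move/negP/negbTE : xy => ->.
Qed.

End Excess.

(** * The jump distribution and the mean excess *)

Section JumpExcess.
Context d (T : measurableType d) (R : realType) (P : probability T R).
Context (X : {RV P >-> R}) (X_ge0 : forall t, 0 <= X t).
Context (mean : R) (X_mean : ('E_P[X] = mean%:E)%E).
Context (K u : R) (u_gt0 : 0 < u) (u_K : 2 * u <= K).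

Local Notation J t := (jump K u (X t)).

(** The integrated tail of the jump distribution on the natural numbers; its
    value at 0 is the mean jump, which is the constant [rho] of the renewal
    equation. *)
Definition jump_excess j : R := 'Ex_P[fun t => (J t - j)%N%:R].

Lemma jump_le (s : R) : 0 <= s -> (jump K u s)%:R <= 2 / u * s.
Proof.
move=> s0; have u0 := u_gt0; have uK := u_K.
have su : 0 <= s / u by rewrite divr_ge0// ltW.
rewrite /jump; case: (leP s K) => sK; first by rewrite mulr_ge0// divr_ge0// ltW.
have h : (Num.trunc (s / u))%:R <= s / u by rewrite truncn_le.
have h2 : 2 <= s / u by rewrite ler_pdivlMr//; lra.
rewrite -addn2 natrD; have -> : 2 / u * s = s / u + s / u by ring.
exact: lerD.
Qed.

Lemma measurable_jump_sub j : measurable_fun setT (fun t => (J t - j)%N%:R : R).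
Proof.
have mJ : measurable_fun setT (fun t => J t).
  move=> _ Y _; rewrite setTI.
  rewrite (_ : _ @^-1` Y = \bigcup_(i in Y) [set t | J t == i]); last first.
    apply/seteqP; split => t /=; first by move=> Yt; exists (J t) => /=.
    by move=> [i Yi /= /eqP ->].
  apply: bigcup_measurable => i _.
  have mi := measurableT_comp (measurable_jump_eq K u i) (@measurable_funPT _ _ _ _ X).
  by have := mi measurableT [set true] Logic.I; rewrite setTI.
have mN : measurable_fun setT (fun n : nat => (n - j)%N%:R : R) by [].
exact: (measurableT_comp mN mJ).
Qed.

Lemma integrable_jump_sub j :
  P.-integrable setT (EFin \o (fun t => (J t - j)%N%:R : R)).
Proof.
have u0 := u_gt0.
have h : P.-integrable setT (EFin \o (fun t => 2 / u * X t)).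
  have := integrableZl measurableT (2 / u) (integrable_mean X_ge0 X_mean).
  by apply: eq_integrable => // t _ /=; rewrite EFinM.
apply: le_integrable h => //; first exact/measurable_EFinP/measurable_jump_sub.
move=> t _ /=; rewrite lee_fin !ger0_norm ?ler0n//; last first.
  by rewrite mulr_ge0// divr_ge0// ltW.
by apply: le_trans (jump_le (X_ge0 t)); rewrite ler_nat leq_subr.
Qed.

Lemma jump_excess_ge0 j : 0 <= jump_excess j.
Proof. by apply: Ex_ge0 => t; exact: ler0n. Qed.

Lemma jump_excessS j :
  jump_excess j = 'Ex_P[fun t => (j < J t)%N%:R] + jump_excess j.+1.
Proof.
rewrite /jump_excess -RintegralD//; last 2 first.
- apply: bounded_measurable_integrable; apply: bounded_measurable_bool.
  exact: (measurableT_comp (measurable_jump_tail K u j) (@measurable_funPT _ _ _ _ X)).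
- exact: integrable_jump_sub.
congr (Rintegral _ _ _); apply/funext => t.
rewrite -natrD; congr (_%:R); case: (ltnP j (J t)) => h /=; nat_lia.
Qed.

Lemma sum_jump_tail_le n :
  \sum_(0 <= i < n) 'Ex_P[fun t => (i < J t)%N%:R] <= jump_excess 0.
Proof.
have -> : jump_excess 0 =
    \sum_(0 <= i < n) 'Ex_P[fun t => (i < J t)%N%:R] + jump_excess n.
  elim: n => [|n IH]; first by rewrite big_geq// add0r.
  by rewrite IH big_nat_recr//= (jump_excessS n) addrA.
by rewrite lerDl jump_excess_ge0.
Qed.

(** The mean jump is small when [K] is large: on the event [K < X], the jump is
    at most [2 X / u], and [X] is at most [2 (X - K / 2)]. *)
Lemma jump_excess0_le : jump_excess 0 <= 4 / u * excess X (K / 2).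
Proof.
have u0 := u_gt0; have uK := u_K.
have K2 : 0 <= K / 2 by lra.
rewrite /jump_excess /excess -RintegralZl//; last exact: integrable_excess X_mean _ K2.
apply: le_Rintegral => //; first exact: integrable_jump_sub.
  have := integrableZl measurableT (4 / u) (integrable_excess X_ge0 X_mean K2).
  by apply: eq_integrable => // t _ /=; rewrite EFinM.
move=> t _; rewrite subn0.
have h : 0 <= 4 / u * Num.max 0 (X t - K / 2).
  by rewrite mulr_ge0// ?divr_ge0 ?le_max ?lexx// ltW.
case: (leP (X t) K) => sK; first by rewrite /jump sK.
apply: (le_trans (jump_le (X_ge0 t))).
rewrite max_r; last by lra.
have -> : 2 / u * X t = u^-1 * (2 * X t) by ring.
have -> : 4 / u * (X t - K / 2) = u^-1 * (4 * (X t - K / 2)) by ring.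
by rewrite ler_pM2l ?invr_gt0//; lra.
Qed.

Lemma jump_excess_le j : jump_excess j.+2 <= u^-1 * excess X (u * j%:R).
Proof.
have u0 := u_gt0; have uK := u_K.
have uj : 0 <= u * j%:R by rewrite mulr_ge0 ?ler0n// ltW.
rewrite /jump_excess /excess -RintegralZl//; last exact: integrable_excess X_mean _ uj.
apply: le_Rintegral => //; first exact: integrable_jump_sub.
  have := integrableZl measurableT (u^-1) (integrable_excess X_ge0 X_mean uj).
  by apply: eq_integrable => // t _ /=; rewrite EFinM.
move=> t _.
have h : 0 <= u^-1 * Num.max 0 (X t - u * j%:R).
  by rewrite mulr_ge0 ?invr_ge0 ?le_max ?lexx// ltW.
rewrite /jump; case: (leP (X t) K) => sK; first by rewrite sub0n.
rewrite !subSS; case: (leqP (Num.trunc (X t / u)) j) => jX.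
  by rewrite (eqP (_ : (_ - _ == 0)%N)) // subn_eq0.
rewrite natrB; last exact: ltnW.
have su : 0 <= X t / u by rewrite divr_ge0// ltW.
have h1 : (Num.trunc (X t / u))%:R <= X t / u by rewrite truncn_le.
apply: (@le_trans _ _ (u^-1 * (X t - u * j%:R))); last first.
  by rewrite ler_pM2l ?invr_gt0// le_max lexx orbT.
by rewrite mulrBr mulKf ?gt_eqF// lerD2r [u^-1 * _]mulrC.
Qed.

(** A jump above [j + 2] forces [X >= u (j + 1)], and then the two excesses differ
    by exactly [u]. *)
Lemma jump_tail_le j : 'Ex_P[fun t => (j.+2 < J t)%N%:R] <=
  u^-1 * (excess X (u * j%:R) - excess X (u * j.+1%:R)).
Proof.
have u0 := u_gt0; have uK := u_K.
have uj i : 0 <= u * i%:R by rewrite mulr_ge0 ?ler0n// ltW.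
have iE i := integrable_excess X_ge0 X_mean (uj i).
rewrite /excess -RintegralB// -RintegralZl//; last first.
  have := integrableB measurableT (iE j) (iE j.+1).
  by apply: eq_integrable => // t _ /=.
apply: le_Rintegral => //.
- apply: bounded_measurable_integrable; apply: bounded_measurable_bool.
  exact: (measurableT_comp (measurable_jump_tail K u j.+2) (@measurable_funPT _ _ _ _ X)).
- have := integrableZl measurableT (u^-1) (integrableB measurableT (iE j) (iE j.+1)).
  by apply: eq_integrable => // t _ /=.
move=> t _; have h0 : u * j%:R <= u * j.+1%:R by rewrite ler_pM2l// ler_nat.
have hE : u * j.+1%:R = u * j%:R + u by rewrite -natr1; ring.
case: ltnP => [|_]; last first.
  rewrite mulr_ge0 ?invr_ge0 ?(ltW u0)// subr_ge0.
  by rewrite ge_max le_max lexx/= le_max; apply/orP; right; lra.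
rewrite /jump; case: (leP (X t) K) => // sK; rewrite !ltnS => jX.
have : j.+1%:R <= X t / u by rewrite -truncn_gt_nat.
rewrite ler_pdivlMr// mulrC => hX.
rewrite !max_r ?subr_ge0//; last by lra.
rewrite hE (_ : _ - _ = u); last by ring.
by rewrite mulVf ?gt_eqF.
Qed.

End JumpExcess.

(** * Subexponential distributions on a lattice *)

Section SubexponentialTail.
Context (R : realType) (G : probability R R) (G_subexp : subexponential G).
Context (u : R) (u_gt0 : 0 < u).

Definition real_tail (x : R) : R := fine (tail G x).

Lemma real_tailE x : tail G x = (real_tail x)%:E.
Proof. by rewrite /real_tail fineK// fin_num_measure. Qed.

Lemma real_tail_ge0 x : 0 <= real_tail x.
Proof. by rewrite fine_ge0. Qed.

Lemma real_tail_nincr x y : x <= y -> real_tail y <= real_tail x.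
Proof.
move=> xy; rewrite -lee_fin -!real_tailE le_measure ?inE//.
by move=> z /=; rewrite !in_itv/= !andbT; exact: le_lt_trans.
Qed.

Lemma real_tail_le1 x : real_tail x <= 1.
Proof. by rewrite -lee_fin -real_tailE probability_le1. Qed.

Lemma real_tail_bool x : 'Ex_G[fun z => (x < z)%R%:R] = real_tail x.
Proof.
rewrite Ex_bool; last exact: measurable_fun_ltr.
rewrite /real_tail /tail; congr (fine (G _)).
by apply/seteqP; split => z /=; rewrite in_itv/= andbT.
Qed.

Lemma nonneg_bool : 'Ex_G[fun z => (0 <= z)%R%:R] = 1.
Proof.
rewrite Ex_bool; last exact: measurable_fun_ler.
rewrite (_ : [set t | 0 <= t] = ~` `]-oo, 0[%classic); last first.
  by apply/seteqP; split => z /=; rewrite in_itv/= leNgt => /negP.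
by rewrite probability_setC// (G_subexp.1) sube0.
Qed.

Lemma real_tail_lt0 x : x < 0 -> real_tail x = 1.
Proof.
move=> x0; apply/eqP; rewrite eq_le real_tail_le1/= -nonneg_bool -real_tail_bool.
apply: Ex_le => [||z].
- by apply: bounded_measurable_bool; exact: measurable_fun_ler.
- by apply: bounded_measurable_bool; exact: measurable_fun_ltr.
by case: (leP 0 z) => // z0; rewrite (lt_le_trans x0 z0).
Qed.

Lemma real_tail_cvg0 (eps : R) : 0 < eps ->
  exists N, forall n, (N <= n)%N -> real_tail (u * n%:R) <= eps.
Proof.
move=> eps0; have u0 := u_gt0.
pose F n : set R := `](u * n%:R), +oo[%classic.
have F0 : \bigcap_n F n = set0.
  apply/seteqP; split => // z /(_ (Num.trunc (Num.max 0 (z / u))).+1 Logic.I).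
  rewrite /F /= in_itv/= andbT mulrC -ltr_pdivlMr// ltNge => /negP; apply.
  have m0 : 0 <= Num.max 0 (z / u) by rewrite le_max lexx.
  have /andP[_ /ltW h] := truncn_itv m0.
  by apply: le_trans h; rewrite le_max lexx orbT.
have h : G (F n) @[n --> \oo] --> G (\bigcap_n F n).
  have mF n : measurable (F n) by exact: measurable_itv.
  apply: nonincreasing_cvg_mu => //.
  - by rewrite ltey_eq fin_num_measure.
  - exact: bigcapT_measurable.
  - move=> m n mn; apply/subsetPset => z; rewrite /F /= !in_itv/= !andbT.
    by apply: le_lt_trans; rewrite ler_pM2l// ler_nat.
rewrite F0 measure0 in h.
move: h => /fine_cvgP[_ /cvgrPdist_le /(_ _ eps0)[N _ hN]].
exists N => n Nn; have := hN n Nn; rewrite /= sub0r normrN => hn.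
exact: le_trans (ler_norm _) hn.
Qed.

Definition conv_tail (x : R) : R := fine (tail (convolution G G) x).

Lemma conv_tailE (x : R) : bounded_measurable (fun z : R => real_tail (x - z)) /\
  conv_tail x = 'Ex_G[fun z : R => real_tail (x - z)].
Proof.
pose A : set (R * R) := [set p | x < p.1 + p.2].
have mA : measurable A.
  have mb : measurable_fun setT (fun p : R * R => x < p.1 + p.2).
    apply: measurable_fun_ltr => //; apply: measurable_funD.
      exact: measurable_fst.
    exact: measurable_snd.
  by have := mb measurableT [set true] Logic.I; rewrite setTI.
have xA z : G (xsection A z) = (real_tail (x - z))%:E.
  rewrite -real_tailE /tail; congr (G _); apply/funext => y; apply/propext.
  by rewrite /xsection/= inE in_itv/= andbT /A/= ltrBlDl.
have m1 : measurable_fun setT (fun z : R => real_tail (x - z)).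
  apply/measurable_EFinP.
  apply: (eq_measurable_fun (G \o xsection A)) => [z _ /=|]; first by rewrite xA.
  exact: measurable_fun_xsection.
split.
  apply: (@bounded_measurable_between _ _ _ _ 0 1 m1) => z.
  by rewrite real_tail_ge0 real_tail_le1.
rewrite /conv_tail /Rintegral; congr fine.
rewrite /tail /convolution /pushforward.
rewrite (_ : _ @^-1` _ = A); last first.
  by apply/seteqP; split => p; rewrite /A/= in_itv/= andbT.
by apply: eq_integral => z _ /=; rewrite -xA.
Qed.

Local Notation b := (fun n : nat => real_tail (u * n%:R)).

(** A lower bound of the convolution by disjoint events: the first variable is at
    most [u L] and the second exceeds [u j]; the first exceeds [u j]; the first
    lies between [u i] and [u (i + 1)] and the second exceeds [u (j - i)]. *)
Lemma conv_tail_ge L j : (L <= j)%N ->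
  b j * (1 - b L) + b j + \sum_(L <= i < j) (b i - b i.+1) * b (j - i)%N
  <= conv_tail (u * j%:R).
Proof.
move=> Lj; have u0 := u_gt0; have [bm ->] := conv_tailE (u * j%:R).
pose B (i : nat) (z : R) : R := (u * i%:R < z)%R%:R.
have bB i : bounded_measurable (B i).
  by apply: bounded_measurable_bool; exact: measurable_fun_ltr.
have EB i : 'Ex_G[B i] = b i by exact: real_tail_bool.
pose B0 (z : R) : R := (0 <= z)%R%:R.
have bB0 : bounded_measurable B0.
  by apply: bounded_measurable_bool; exact: measurable_fun_ler.
have bZ (c : R) (f : R -> R) : bounded_measurable f ->
    bounded_measurable (fun t => c * f t).
  by move=> bf; apply: bounded_measurableM => //; exact: bounded_measurable_cst.
pose S i z : R := b (j - i)%N * (B i z + -1 * B i.+1 z).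
have bS i : bounded_measurable (S i).
  by apply: (bZ _ _ _); apply: bounded_measurableD => //; exact: bZ.
(* A step function below the tail of the second variable given that the first
   one equals z. *)
pose F z : R := b j * (B0 z + -1 * B L z) + (B j z + \sum_(L <= i < j) S i z).
have bSS := bounded_measurable_sum (index_iota L j) bS.
have bF1 : bounded_measurable (fun z => b j * (B0 z + -1 * B L z)).
  by apply: (bZ _ _ _); apply: bounded_measurableD => //; exact: bZ.
have bF2 : bounded_measurable (fun z => B j z + \sum_(L <= i < j) S i z).
  exact: bounded_measurableD.
have bF : bounded_measurable F by exact: bounded_measurableD.
apply: (@le_trans _ _ ('Ex_G[F])).
  rewrite /F ExD// ExZ; last by apply: bounded_measurableD => //; exact: bZ.
  rewrite ExD//; last exact: bZ.
  rewrite ExZ// ExD// Ex_sum// !EB nonneg_bool.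
  rewrite le_eqVlt; apply/orP; left; apply/eqP.
  rewrite -addrA mulN1r; congr (_ + (_ + _)); apply: eq_bigr => i _.
  rewrite /S ExZ; last by apply: bounded_measurableD => //; exact: bZ.
  by rewrite ExD//; [rewrite ExZ// !EB mulN1r mulrC|exact: bZ].
apply: Ex_le => // z; rewrite /F.
set g := real_tail (u * j%:R - z).
have g0 : 0 <= g by exact: real_tail_ge0.
have Bmono m n : (m <= n)%N -> B n z <= B m z.
  move=> mn; rewrite /B ler_nat; case: ltP => // h.
  by rewrite (le_lt_trans _ h)// ler_pM2l// ler_nat.
have Sle i : (i < j)%N -> S i z <= g * (B i z - B i.+1 z).
  move=> ij; rewrite /S mulN1r.
  have d0 : 0 <= B i z - B i.+1 z by rewrite subr_ge0 Bmono.
  rewrite /B in d0 *; case: (ltP (u * i%:R) z) d0 => h1 /=; last first.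
    have -> : (u * i.+1%:R < z) = false.
      by apply/negbTE; rewrite -leNgt (le_trans h1)// ler_pM2l// ler_nat.
    by rewrite subrr !mulr0.
  move=> d0; rewrite ler_wpM2r//; apply: real_tail_nincr.
  by rewrite natrB ?(ltnW ij)// mulrBr lerB// ltW.
have SS : \sum_(L <= i < j) S i z <= g * (B L z - B j z).
  apply: (@le_trans _ _ (\sum_(L <= i < j) g * (B i z - B i.+1 z))).
    by rewrite big_nat [leRHS]big_nat ler_sum// => i /andP[_ ij]; exact: Sle.
  rewrite -mulr_sumr; have -> : \sum_(L <= i < j) (B i z - B i.+1 z) = B L z - B j z.
    rewrite -[RHS]opprB -(telescope_sumr (fun i => B i z))// -sumrN.
    by apply: eq_bigr => i _; rewrite opprB.
  by [].
have [z0|z0] := ltP z 0.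
  have BN i : B i z = 0.
    by rewrite /B ltNge (le_trans (ltW z0))//= mulr_ge0 ?ler0n// ltW.
  have -> : B0 z = 0 by rewrite /B0 leNgt z0.
  rewrite !BN in SS *; lra.
have B0z : B0 z = 1 by rewrite /B0 z0.
rewrite B0z; case: (boolP (u * L%:R < z)) => hL; last first.
  have BLz : B L z = 0 by rewrite /B (negbTE hL).
  have Bjz : B j z = 0.
    by apply/eqP; rewrite eq_le -{1}BLz Bmono// /B ler0n.
  have : b j <= g by apply: real_tail_nincr; rewrite gerBl.
  rewrite BLz Bjz in SS *; lra.
have BLz : B L z = 1 by rewrite /B hL.
rewrite BLz in SS *; case: (boolP (u * j%:R < z)) => hj; last first.
  have Bjz : B j z = 0 by rewrite /B (negbTE hj).
  rewrite Bjz in SS *; lra.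
have Bjz : B j z = 1 by rewrite /B hj.
have : g = 1 by apply: real_tail_lt0; rewrite subr_lt0.
rewrite Bjz in SS *; lra.
Qed.

Lemma conv_tail_ratio (l : R) : 2 < l ->
  exists N, forall n, (N <= n)%N -> conv_tail (u * n%:R) <= l * b n.
Proof.
move=> l2; have u0 := u_gt0.
have e0 : 0 < Num.min 1 (l - 2) by rewrite lt_min ltr01 subr_gt0.
have := G_subexp.2 => /cvgrPdist_lt /(_ _ e0)[M [_ hM]].
exists (Num.trunc (Num.max 0 (M / u))).+1 => n Mn.
have MN : M < u * n%:R.
  have m0 : 0 <= Num.max 0 (M / u) by rewrite le_max lexx.
  have /andP[_ h] := truncn_itv m0.
  rewrite mulrC -ltr_pdivrMr// (@le_lt_trans _ _ (Num.max 0 (M / u)))//.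
    by rewrite le_max lexx orbT.
  by rewrite (lt_le_trans h)// ler_nat.
have := hM _ MN; rewrite -/(conv_tail _) -/(real_tail _).
have : Num.min 1 (l - 2) <= 1 by rewrite ge_min lexx.
have : Num.min 1 (l - 2) <= l - 2 by rewrite ge_min lexx orbT.
move: (Num.min _ _) => e el e1.
rewrite ltr_norml => /andP[h1 h2].
have b0 : b n != 0.
  apply/eqP => bn0; move: h2; rewrite bn0 invr0 mulr0 subr0; lra.
have bpos : 0 < b n by rewrite lt_neqAle eq_sym b0 real_tail_ge0.
by rewrite -ler_pdivrMr//; lra.
Qed.

Lemma real_tail_gt0 x : 0 < real_tail x.
Proof.
have u0 := u_gt0.
have := G_subexp.2 => /cvgrPdist_lt /(_ _ ltr01)[M [_ hM]].
pose y := Num.max x (M + 1).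
have My : M < y by rewrite /y lt_max; apply/orP; right; lra.
have := hM _ My; rewrite -/(conv_tail _) -/(real_tail _).
rewrite ltr_norml => /andP[h1 h2].
have b0 : real_tail y != 0.
  apply/eqP => bn0; move: h2; rewrite bn0 invr0 mulr0 subr0; lra.
have bpos : 0 < real_tail y by rewrite lt_neqAle eq_sym b0 real_tail_ge0.
by apply: lt_le_trans bpos _; apply: real_tail_nincr; rewrite /y le_max lexx.
Qed.

(** The first two events of [conv_tail_ge] already account for almost twice the
    tail, so nothing is left for the others. *)
Lemma real_tail_subexponential_seq : subexponential_seq b.
Proof.
move=> e e0.
have e2 : 0 < e / 2 by lra.
have [L hL] := real_tail_cvg0 e2.
have l2 : 2 < 2 + e / 2 by lra.
have [N hN] := conv_tail_ratio l2.
exists L, (maxn L N) => j; rewrite geq_max => /andP[Lj Nj].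
have := conv_tail_ge Lj; have := hN j Nj; have := hL L (leqnn L).
have := real_tail_ge0 (u * j%:R).
by move: (\sum_(_ <= _ < _) _) => S; move: (b j) (b L) (conv_tail _) => x y z *; nra.
Qed.

(** Take [L = 1] in [conv_tail_ge]; by monotonicity the sum is at least
    [b n * (b 1 - b n.+1)], which leaves [b n] no room above [b n.+1]. *)
Lemma real_tail_long_tailed_seq : long_tailed_seq b.
Proof.
move=> l l1; have u0 := u_gt0.
have b1 : 0 < b 1%N by exact: real_tail_gt0.
(* With this e, b 1 + e = l * (b 1 - e). *)
have [e e0 eE] : exists2 e, 0 < e & e * (l + 1) = b 1%N * (l - 1).
  exists (b 1%N * (l - 1) / (l + 1)); first by rewrite divr_gt0 ?mulr_gt0//; lra.
  by rewrite divfK// gt_eqF//; lra.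
have [N1 h1] := real_tail_cvg0 e0.
have l2 : 2 < 2 + e by lra.
have [N2 h2] := conv_tail_ratio l2.
exists (maxn 1 (maxn N1 N2)) => n; rewrite !geq_max => /and3P[n1 nN1 nN2].
have := conv_tail_ge (ltn0Sn n : 1 <= n.+1)%N.
have := h2 n.+1 (leqW nN2); have := h1 n.+1 (leqW nN1).
have S : b n * (b 1%N - b n.+1) <=
    \sum_(1 <= i < n.+1) (b i - b i.+1) * b (n.+1 - i)%N.
  rewrite -[b 1%N - _]opprB -(telescope_sumr b)// -sumrN mulr_sumr.
  rewrite big_nat [leRHS]big_nat ler_sum// => i /andP[i1 ij].
  rewrite opprB mulrC ler_wpM2l// ?subr_ge0.
    by apply: real_tail_nincr; rewrite ler_pM2l// ler_nat.
  by apply: real_tail_nincr; rewrite ler_pM2l// ler_nat; nat_lia.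
move: S; have := real_tail_ge0 (u * n%:R); have := real_tail_ge0 (u * n.+1%:R).
move: (\sum_(_ <= _ < _) _) => S.
move: eE b1; move: (b 1%N) (b n) (b n.+1) (conv_tail _).
move=> x y z c eE b1 z0 y0 S1 ze cz cS.
have k1 : y * (x - e) <= (e + x) * z by nra.
have xe : 0 < x - e by nra.
have k2 : (e + x) <= l * (x - e) by nra.
rewrite -(ler_pM2r xe) (le_trans k1)//.
have -> : l * z * (x - e) = l * (x - e) * z by ring.
by rewrite ler_wpM2r.
Qed.

End SubexponentialTail.

(** * A tail bound uniform in the number of customers *)

Lemma trunc_ge (R : realType) (x : R) (n : nat) : n%:R <= x -> (n <= Num.trunc x)%N.
Proof. by move=> nx; rewrite truncn_ge_nat// (le_trans _ nx)// ler0n. Qed.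

Lemma trunc_gt (R : realType) (x : R) : x < (Num.trunc x).+1%:R.
Proof.
have [x0|x0] := leP 0 x; first by have /andP[] := truncn_itv x0.
by rewrite (lt_le_trans x0)// ler0n.
Qed.

(** Any large level lies within a bounded number of lattice steps above
    [c + u N]. *)
Lemma lattice_bracket (R : realType) (u c : R) N0 : 0 < u -> 0 < c ->
  forall y, c + u * N0%:R <= y -> exists N, [/\ (N0 <= N)%N, c + u * N%:R <= y &
    y <= u * (N + (Num.trunc (c / u)).+2)%:R].
Proof.
move=> u0 c0 y hy; exists (Num.trunc ((y - c) / u)).
have N0y : N0%:R <= (y - c) / u by rewrite ler_pdivlMr// mulrC; lra.
have yc0 : 0 <= (y - c) / u by apply: le_trans N0y; exact: ler0n.
have /andP[] := truncn_itv yc0.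
have := trunc_gt (c / u).
rewrite ler_pdivlMr// !ltr_pdivrMr// => h1 h2 h3; split.
- exact: trunc_ge.
- by rewrite mulrC; lra.
have -> : (Num.trunc ((y - c) / u) + (Num.trunc (c / u)).+2)%:R =
    (Num.trunc ((y - c) / u)).+1%:R + (Num.trunc (c / u)).+1%:R :> R.
  by rewrite -natrD !addnS addSn.
by rewrite mulrC mulrDl; lra.
Qed.

Section UniformBound.
Context d (T : measurableType d) (R : realType) (P : probability T R).
Context (tau sigma : nat -> {RV P >-> R}) (a b : R).
Context (tau_ge0 : forall n t, 0 <= tau n t) (sigma_ge0 : forall n t, 0 <= sigma n t).
Context (tau_iid : iid tau) (sigma_iid : iid sigma).
Context (tau_sigma_indep : independent_sequences tau sigma).
Context (tau_mean : ('E_P[tau 0%N] = a%:E)%E).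
Context (sigma_mean : ('E_P[sigma 0%N] = b%:E)%E).
Context (le_ab : a <= b) (lt_b2a : b < 2 * a).
Context (BI : probability R R).
Context (BI_def : is_integrated_tail (distribution P (sigma 0%N)) BI).
Context (BI_subexp : subexponential BI).

Local Notation work := (residual_work tau sigma).
Local Notation I := (excess (sigma 0%N)).
Local Notation tBI := (real_tail BI).

(** Far enough, the minimum in the definition of the integrated tail is the
    integral. *)
Lemma integrated_tail_eventually : exists2 x0 : R, 0 < x0 &
  forall x : R, x0 <= x -> tBI x = I x.
Proof.
have [x0 x00 h] := excess_cvg0 (sigma_ge0 0%N) sigma_mean ltr01.
exists x0 => // x xx0; have x_gt0 : 0 < x by exact: lt_le_trans xx0.
rewrite /real_tail (BI_def.2 _ x_gt0) (layer_cake (sigma_ge0 0%N) sigma_mean x_gt0).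
by rewrite min_r// lee_fin h.
Qed.

Lemma trimmed_mean K : 'Ex_P[fun t => sigma 0%N t * (sigma 0%N t <= K)%R%:R] <= b.
Proof.
apply: (@le_trans _ _ ('Ex_P[fun t => sigma 0%N t])); last first.
  by rewrite le_eqVlt; apply/orP; left; apply/eqP; exact: Ex_mean sigma_mean.
apply: le_Rintegral => //.
- apply: le_integrable (integrable_mean (sigma_ge0 0%N) sigma_mean) => //.
    apply/measurable_EFinP; apply: measurable_funM => //.
    have [] := @bounded_measurable_bool _ T R (fun t => sigma 0%N t <= K) => //.
    exact: measurable_fun_ler.
  move=> t _ /=; rewrite lee_fin normrM ler_piMr//.
  by rewrite ger0_norm ?ler0n// lern1 leq_b1.
- by have := integrable_mean (sigma_ge0 0%N) sigma_mean.
- by move=> t _; rewrite ler_piMr// lern1 leq_b1.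
Qed.

(** The constraints linking the level [C] of the corrector, the truncation levels
    [K] and [cap], the lattice step [u], the error [e] and the exponent [th].  In
    [negative_drift], [4 * e] gathers the errors of order [e], the next term is
    the cost of capping interarrival times, and the last one the quadratic error
    of the exponential. *)
Record admissible (C K cap u e th : R) : Prop := Admissible {
  C_gt0 : 0 < C;
  K_ge : 2 * u <= K;
  cap_gt0 : 0 < cap;
  u_gt0 : 0 < u;
  e_gt0 : 0 < e;
  th_gt0 : 0 < th;
  C_large : K ^+ 2 + cap ^+ 2 <= 2 * C * e;
  th_small : th * drift_bound K cap u e <= 1 / 2;
  cap_mean : a - e <= 'Ex_P[fun t => Num.min (tau 0%N t) cap];
  negative_drift : u + 4 * e + 2 * cap * jump_excess (sigma 0%N) K u 0
    + 2 * th * drift_bound K cap u e ^+ 2 <= 2 * a - b }.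

(** The parameters are fixed in the order [e], [cap], [K], [C], [th]; each
    constraint holds once the parameter fixed last is extreme enough. *)
Lemma admissible_exists (dl : R) : 0 < dl < 1 ->
  let u := (2 * a - b) * (1 - dl) in exists C K cap e th,
    admissible C K cap u e th /\ jump_excess (sigma 0%N) K u 0 <= dl.
Proof.
move=> /andP[dl0 dl1]; set m := 2 * a - b => u.
have m0 : 0 < m by rewrite /m subr_gt0.
have u0 : 0 < u by rewrite /u mulr_gt0// subr_gt0.
(* The drift constraint spends 4 e explicitly, e on capping and e on the
   quadratic error. *)
pose e := m * dl / 6; have e0 : 0 < e by rewrite /e divr_gt0// mulr_gt0.
have uE : u + 6 * e = m by rewrite /u /e; field.
move: u0 uE e0; move: u e => u e u0 uE e0.
have [cap cap0 hcap] := excess_cvg0 (tau_ge0 0%N) tau_mean e0.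
have cap_mean : a - e <= 'Ex_P[fun t => Num.min (tau 0%N t) cap].
  rewrite (Ex_min_cap (tau_ge0 0%N) tau_mean (ltW cap0)) lerD2l lerN2.
  exact: hcap.
have cap1 : 0 < 2 * cap + 1 by lra.
pose rho := Num.min dl (e / (2 * cap + 1)).
have rho0 : 0 < rho by rewrite /rho lt_min dl0/= divr_gt0.
have rho_dl : rho <= dl by rewrite /rho ge_min lexx.
have rho_cap : 2 * cap * rho <= e.
  have : rho <= e / (2 * cap + 1) by rewrite /rho ge_min lexx orbT.
  by rewrite ler_pdivlMr//; lra.
move: rho rho0 rho_dl rho_cap => rho rho0 rho_dl rho_cap.
have ru0 : 0 < rho * u / 4 by rewrite divr_gt0// mulr_gt0.
have [x1 x10 hx1] := excess_cvg0 (sigma_ge0 0%N) sigma_mean ru0.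
pose K := 2 * u + 2 * x1.
have uK : 2 * u <= K by rewrite /K; lra.
have jump_rho : jump_excess (sigma 0%N) K u 0 <= rho.
  apply: (le_trans (jump_excess0_le (sigma_ge0 0%N) sigma_mean u0 uK)).
  have h : excess (sigma 0%N) (K / 2) <= rho * u / 4 by apply: hx1; rewrite /K; lra.
  have -> : rho = 4 / u * (rho * u / 4) by field; rewrite gt_eqF.
  by rewrite ler_pM2l// divr_gt0.
have K0 : 0 <= K by rewrite (le_trans _ uK)// mulr_ge0// ltW.
move: K uK K0 jump_rho => K uK K0 jump_rho.
pose C := (K ^+ 2 + cap ^+ 2) / (2 * e) + 1.
pose B := drift_bound K cap u e.
have Be : e <= B by rewrite /B /drift_bound; lra.
have B0 : 0 < B by exact: lt_le_trans Be.
pose th := e / (2 * B ^+ 2).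
have th0 : 0 < th by rewrite /th divr_gt0// mulr_gt0// exprn_gt0.
exists C, K, cap, e, th; split; last exact: le_trans rho_dl.
split=> //.
- rewrite /C ltr_wpDl// divr_ge0//; first by rewrite addr_ge0 ?sqr_ge0.
  by rewrite mulr_ge0// ltW.
- have -> : 2 * C * e = K ^+ 2 + cap ^+ 2 + 2 * e by rewrite /C; field; rewrite gt_eqF.
  by rewrite lerDl mulr_ge0// ltW.
- rewrite -/B (_ : th * B = e / (2 * B)); last by rewrite /th; field; rewrite gt_eqF.
  by rewrite ler_pdivrMr ?mulr_gt0//; lra.
rewrite -/B (_ : 2 * th * B ^+ 2 = e); last by rewrite /th; field; rewrite gt_eqF.
have : 2 * cap * jump_excess (sigma 0%N) K u 0 <= e.
  by apply: le_trans rho_cap; rewrite ler_wpM2l// mulr_ge0// ltW.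
by rewrite -/m; lra.
Qed.

(** The dominating process, whose tail [r] inherits the asymptotics of the
    integrated tail on the lattice of step [u]. *)
Lemma renewal_domination C K cap u e th : admissible C K cap u e th ->
  jump_excess (sigma 0%N) K u 0 < 1 -> exists r : nat -> R,
  [/\ exists2 M, 0 < M & forall j, r j <= M * tBI (u * j%:R),
      forall k, u^-1 / (1 - jump_excess (sigma 0%N) K u 0) < k ->
        exists N, forall j, (N <= j)%N -> r j <= k * tBI (u * j%:R) &
      forall n N L y, 3 * C + K + u * N%:R <= y ->
        fine (P [set t | y <= 2 * (work n t).1]) <= r (N - L)%N +
        \sum_(0 <= j < N - L) expR (- (th * u)) ^+ (N - j) * (r j / (th * e))].
Proof.
move=> [C0 uK cap0 u0 e0 th0 CL ths cm nd].
set rho := jump_excess (sigma 0%N) K u 0 => rho1.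
have K0 : 0 <= K by rewrite (le_trans _ uK)// mulr_ge0// ltW.
pose q := jump_tail sigma K u; pose H := jump_excess (sigma 0%N) K u.
pose p := jump_pmf sigma K u.
have q_ge0 i : 0 <= q i by apply: Ex_ge0 => t; exact: ler0n.
have H_ge0 i : 0 <= H i by exact: jump_excess_ge0.
have HS j : H j = q j + H j.+1.
  exact: (jump_excessS (sigma_ge0 0%N) sigma_mean u0 uK).
have q_sum n : \sum_(0 <= i < n) q i <= rho.
  exact: (sum_jump_tail_le (sigma_ge0 0%N) sigma_mean u0 uK).
have q0rho : q 0%N <= rho by have := q_sum 1%N; rewrite big_nat1.
have [r [r0 r_ge0 rE]] := renewal_solution q_ge0 (le_lt_trans q0rho rho1) H_ge0.
have p0q0 : p 0%N + q 0%N = 1 by exact: jump_pmf0_tail0.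
have pS i : q i = p i.+1 + q i.+1 by exact: jump_tailS.
have r_super := renewal_solution_super rE p0q0 pS HS.
have nd' : u + 4 * e + 2 * cap * (1 - p 0%N)
    + 2 * th * drift_bound K cap u e ^+ 2 <= 2 * a - b.
  apply: le_trans nd; rewrite lerD2r lerD2l ler_wpM2l//.
    by rewrite mulr_ge0// ltW.
  by rewrite -p0q0 addrAC subrr add0r.
pose bs n := tBI (u * n%:R).
have bs_gt0 n : 0 < bs n by exact: real_tail_gt0.
have bs_dec i j : (i <= j)%N -> bs j <= bs i.
  by move=> ij; apply: real_tail_nincr; rewrite ler_pM2l// ler_nat.
have bs_long : long_tailed_seq bs by exact: real_tail_long_tailed_seq.
have bs_sub : subexponential_seq bs by exact: real_tail_subexponential_seq.
have [x0 x00 hx0] := integrated_tail_eventually.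
pose NI := (Num.trunc (x0 / u)).+1.
have bsI i : (NI <= i)%N -> excess (sigma 0%N) (u * i%:R) = bs i.
  move=> Ni; rewrite /bs hx0// mulrC -ler_pdivrMr//.
  by apply: (le_trans (ltW (trunc_gt _))); rewrite ler_nat.
have ui0 : 0 <= u^-1 by rewrite invr_ge0 ltW.
have q_le : exists N, forall i, (N <= i)%N -> q i.+2 <= u^-1 * (bs i - bs i.+1).
  exists NI => i Ni; rewrite -!bsI//; last exact: leqW.
  exact: (jump_tail_le (sigma_ge0 0%N) sigma_mean u0 uK).
have H_le : exists N, forall i, (N <= i)%N -> H i.+2 <= u^-1 * bs i.
  exists NI => i Ni; rewrite -bsI//.
  exact: (jump_excess_le (sigma_ge0 0%N) sigma_mean u0 uK).
exists r; split.
- exact: renewal_bounded bs_gt0 bs_dec bs_long bs_sub ui0 q_ge0 q_sum rho1 q_le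
    H_le r_ge0 rE.
- move=> k; exact: (renewal_limsup bs_gt0 bs_dec bs_long bs_sub ui0 q_ge0 q_sum
    rho1 q_le H_le r_ge0 rE).
- move=> n N L y; exact: (work_tail_le tau_ge0 sigma_ge0 tau_iid sigma_iid
    tau_sigma_indep C0 K0 (ltW cap0) u0 e0 th0 CL ths le_ab cm (trimmed_mean K)
    nd' r0 r_ge0 r_super).
Qed.

(** The constant [1 / (u (1 - rho))] of [renewal_limsup] tends to
    [1 / (2 a - b)] when [u] tends to [2 a - b] and [rho] to 0. *)
Lemma uniform_tail_bound (eps : R) : 0 < eps -> exists y0 : R, forall y : R, y0 <= y ->
  forall n, fine (P [set t | y <= 2 * (work n t).1]) <= (1 + eps) / (2 * a - b) * tBI y.
Proof.
move=> eps0.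
have m0 : 0 < 2 * a - b by rewrite subr_gt0.
(* Shrinking eps makes the quadratic terms in eps harmless. *)
wlog eps1 : eps eps0 / eps <= 1 => [hw|].
  have [e1|e1] := leP eps 1; first exact: hw.
  have [y0 hy] := hw 1 ltr01 (lexx _); exists y0 => y yy n.
  apply: (le_trans (hy y yy n)); rewrite ler_wpM2r ?real_tail_ge0//.
  by rewrite ler_pM2r ?invr_gt0// lerD2l ltW.
have num : [/\ 0 < 1 + eps / 2, 1 + eps / 2 < 1 + eps, 0 < 1 + eps &
    1 < (1 + eps / 2) * ((1 - eps / 8) * (1 - eps / 8))] by split; nra.
have [eps2_gt0 eps_half eps1_gt0 eps_prod] := num.
(* Two factors 1 - dl are lost, one in u and one in 1 - rho; the factor
   1 + eps / 2 outweighs them. *)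
pose dl := eps / 8.
have dl01 : 0 < dl < 1 by rewrite /dl; apply/andP; split; lra.
have := admissible_exists dl01.
set m := 2 * a - b in m0 *; set u := m * (1 - dl).
move=> [C [K [cap [e [th [adm rho_dl]]]]]].
have [/andP[dl0 dl1] rho1] := (dl01, le_lt_trans rho_dl (andP dl01).2).
have [r [[M M0 rM] r_limsup work_r]] := renewal_domination adm rho1.
have [C0 uK _ u0 e0 th0 _ _ _ _] := adm.
set rho := jump_excess _ _ _ _ in rho_dl rho1 r_limsup.
pose k := (1 + eps / 2) / m.
have k_gt : u^-1 / (1 - rho) < k.
  rewrite -invfM -div1r /k ltr_pdivrMr ?mulr_gt0 ?subr_gt0//.
  have -> : (1 + eps / 2) / m * (u * (1 - rho)) =
      (1 + eps / 2) * ((1 - dl) * (1 - rho)).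
    by rewrite /u; field; rewrite gt_eqF.
  have h : (1 - dl) * (1 - dl) <= (1 - dl) * (1 - rho).
    by rewrite ler_pM2l ?subr_gt0// lerD2l lerN2.
  apply: (@lt_le_trans _ _ ((1 + eps / 2) * ((1 - dl) * (1 - dl)))).
    exact: eps_prod.
  by rewrite ler_pM2l.
have k0 : 0 <= k by rewrite /k divr_ge0 ?ltW.
have kk' : k < (1 + eps) / m by rewrite /k ltr_pM2r ?invr_gt0.
have bs_gt0 n : 0 < tBI (u * n%:R) by exact: real_tail_gt0.
have bs_dec i j : (i <= j)%N -> tBI (u * j%:R) <= tBI (u * i%:R).
  by move=> ij; apply: real_tail_nincr; rewrite ler_pM2l// ler_nat.
have bs_long := real_tail_long_tailed_seq BI_subexp u0.
have s01 : 0 < expR (- (th * u)) < 1.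
  by rewrite expR_gt0/= expR_lt1 oppr_lt0 mulr_gt0.
pose c := 3 * C + K.
have c0 : 0 < c.
  by rewrite /c ltr_wpDr ?mulr_gt0// (le_trans _ uK)// mulr_ge0// ltW.
have [L [N0 hN0]] := lattice_tail_le (Num.trunc (c / u)).+2 bs_gt0 bs_dec bs_long
  s01 (mulr_gt0 th0 e0) k0 kk' M0 rM (r_limsup _ k_gt).
exists (c + u * N0%:R) => y hy n.
have [N [N0N cN yN]] := lattice_bracket u0 c0 hy.
apply: (le_trans (work_r n N L y cN)); apply: (le_trans (hN0 N N0N)).
rewrite ler_pM2l; last exact: divr_gt0.
exact: real_tail_nincr.
Qed.

End UniformBound.

(** * Passage to the weak limit *)

Section WeakLimit.
Context d (T : measurableType d) d' (T' : measurableType d') (R : realType).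

(** A continuous function between the indicators of the half-lines from [x] and
    from [x - 1] transfers the bound to the limit. *)
Lemma weak_limit_tail_le (P : probability T R) (X : nat -> T -> R)
    (P' : probability T' R) (Z : {RV P' >-> R}) (x M : R) :
  (forall n, measurable_fun setT (X n)) -> cvg_in_distribution P X Z ->
  (forall n, fine (P [set t | x - 1 <= X n t]) <= M) ->
  (P' [set t | (x <= Z t)%R] <= M%:E)%E.
Proof.
move=> mX XZ hM.
pose f (z : R) : R := Num.min 1 (Num.max 0 (z - (x - 1))).
have f01 z : 0 <= f z <= 1.
  by rewrite /f le_min ler01 le_max lexx/= ge_min lexx.
have cf : continuous f.
  have c1 : continuous (fun z : R => z - (x - 1)).
    by move=> z; apply: cvgB; [exact: cvg_id|exact: cvg_cst].
  apply: (@min_fun_continuous _ R R (cst 1) (cst 0 \max (fun z => z - (x - 1)))).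
    exact: cst_continuous.
  by apply: max_fun_continuous => //; exact: cst_continuous.
have mf : measurable_fun setT f by exact: continuous_measurable_fun.
have bf : exists M, forall z, `|f z| <= M.
  by exists 1 => z; have /andP[h1 h2] := f01 z; rewrite ger0_norm.
have mA n : measurable [set t | x - 1 <= X n t].
  have mb : measurable_fun setT (fun t => x - 1 <= X n t) by exact: measurable_fun_ler.
  by have := mb measurableT [set true] Logic.I; rewrite setTI.
have mB : measurable [set t | x <= Z t].
  have mb : measurable_fun setT (fun t => x <= Z t) by exact: measurable_fun_ler.
  by have := mb measurableT [set true] Logic.I; rewrite setTI.
have h1 n : ('E_P[f \o X n] <= M%:E)%E.
  apply: (@le_trans _ _ ('E_P[\1_[set t | (x - 1 <= X n t)%R]])%E).
    apply: expectation_le => //.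
    - exact: measurableT_comp.
    - by move=> t; have /andP[] := f01 (X n t).
    - apply: aeW => t /=; rewrite indicE.
      case: (boolP (x - 1 <= X n t)) => h; last first.
        by rewrite /f min_r max_l// ?ler01//; rewrite subr_le0 ltW// ltNge.
      by rewrite mem_set//; have /andP[] := f01 (X n t).
  rewrite expectation_indic//.
  by have := hM n; rewrite -lee_fin fineK// fin_num_measure.
apply: (@le_trans _ _ ('E_P'[f \o Z])%E); last first.
  have := XZ f cf bf => hl; rewrite -(cvg_lim _ hl)//.
  apply: lime_le; first by apply/cvg_ex; eexists; exact: hl.
  exact: nearW.
rewrite -(expectation_indic P' mB); apply: expectation_le => //.
- exact: measurableT_comp.
- by move=> t; have /andP[] := f01 (Z t).
apply: aeW => t /=; rewrite indicE.
case: (boolP (x <= Z t)) => h; last first.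
  by rewrite memNset//=; [have /andP[] := f01 (Z t)|exact/negP].
by rewrite mem_set// /f le_min lexx le_max/=; apply/orP; right; lra.
Qed.

End WeakLimit.

(** The unit lost in [weak_limit_tail_le] is immaterial for a long tail. *)
Lemma real_tail_shift (R : realType) (G : probability R R) (l : R) : subexponential G ->
  1 < l -> exists x0 : R, forall x : R, x0 <= x ->
    real_tail G (x - 2) <= l * real_tail G x.
Proof.
move=> sG l1.
have b0 n : 0 <= real_tail G (1 * n%:R) by exact: real_tail_ge0.
have bl := real_tail_long_tailed_seq sG ltr01.
have [N hN] := long_tailed_shift 3 b0 bl l1.
exists (N.+2)%:R => x Nx.
pose n := Num.trunc (x - 2).
have x2 : 0 <= x - 2.
  by rewrite subr_ge0 (le_trans _ Nx)// ler_nat.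
have /andP[n1 n2] := truncn_itv x2.
have Nn : (N <= n)%N.
  by apply: trunc_ge; rewrite -(lerD2r 2) subrK -natrD addn2.
apply: (@le_trans _ _ (real_tail G (1 * n%:R))).
  by apply: real_tail_nincr; rewrite mul1r.
apply: (le_trans (hN n Nn)); rewrite ler_wpM2l//; first by lra.
apply: real_tail_nincr; rewrite mul1r natrD.
by move: n2; rewrite -/n -natr1; lra.
Qed.

Theorem theorem6 (R : realType)
    (d : measure_display) (T : measurableType d) (P : probability T R)
    (tau sigma : nat -> {RV P >-> R}) (a b : R)
    (tau_ge0 : forall n t, 0 <= tau n t)
    (sigma_ge0 : forall n t, 0 <= sigma n t)
    (tau_iid : iid tau) (sigma_iid : iid sigma)
    (tau_sigma_indep : independent_sequences tau sigma)
    (tau_mean : ('E_P[tau 0%N] = a%:E)%E) (a_gt0 : 0 < a)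
    (sigma_mean : ('E_P[sigma 0%N] = b%:E)%E) (b_gt0 : 0 < b)
    (le_ab : a <= b) (lt_b2a : b < 2 * a)
    (B_subexp : subexponential (distribution P (sigma 0%N)))
    (BI : probability R R)
    (BI_def : is_integrated_tail (distribution P (sigma 0%N)) BI)
    (BI_subexp : subexponential BI)
    (d' : measure_display) (T' : measurableType d') (P' : probability T' R)
    (W : {RV P' >-> R})
    (W_stationary :
      cvg_in_distribution P (fun n t => (residual_work tau sigma n t).1) W) :
  exists2 e : R -> R, e x @[x --> +oo] --> (0 : R) &
    \forall x \near +oo%R,
      (P' [set t | (x <= W t)%R]
       <= ((1 + e x) / (2 * a - b))%:E * tail BI (2 * x))%E.
Proof.
pose m := 2 * a - b; have m0 : 0 < m by rewrite /m subr_gt0.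
pose pW x := fine (P' [set t | x <= W t]).
have pWE x : P' [set t | x <= W t] = (pW x)%:E.
  rewrite /pW fineK// fin_num_measure//.
  have mb : measurable_fun setT (fun t => x <= W t) by exact: measurable_fun_ler.
  by have := mb measurableT [set true] Logic.I; rewrite setTI.
pose tB x := real_tail BI (2 * x).
have tB0 x : 0 < tB x by exact: (real_tail_gt0 BI_subexp ltr01).
pose e x := Num.max 0 (pW x * m / tB x - 1).
have pW_le (eps : R) : 0 < eps -> exists x0 : R, forall x : R, x0 <= x ->
    pW x <= (1 + eps) / m * tB x.
  move=> eps0; pose l := 1 + Num.min 1 eps / 3.
  have mi0 : 0 < Num.min 1 eps by rewrite lt_min ltr01.
  have mi1 : Num.min 1 eps <= 1 by rewrite ge_min lexx.
  have mi2 : Num.min 1 eps <= eps by rewrite ge_min lexx orbT.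
  have l1 : 1 < l by rewrite /l; lra.
  have ll : l * l <= 1 + eps.
    by rewrite /l; move: mi0 mi1 mi2; move: (Num.min _ _) => z *; nra.
  have e0 : 0 < Num.min 1 eps / 3 by lra.
  have [y0 hy0] := uniform_tail_bound tau_ge0 sigma_ge0 tau_iid sigma_iid
    tau_sigma_indep tau_mean sigma_mean le_ab lt_b2a BI_def BI_subexp e0.
  have [x1 hx1] := real_tail_shift BI_subexp l1.
  exists (Num.max (y0 / 2 + 1) (x1 / 2)) => x; rewrite ge_max => /andP[xy0 xx1].
  rewrite -lee_fin -pWE; apply: (weak_limit_tail_le _ W_stationary) => [n|n].
    exact: past_measurable_fun (past_measurable_work tau sigma n).1.
  have yx : y0 <= 2 * x - 2 by lra.
  have := hy0 _ yx n; rewrite (_ : [set t | _] =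
      [set t | x - 1 <= (residual_work tau sigma n t).1]); last first.
    apply/funext => t; apply/propext; split => /= h; lra.
  move=> h; apply: (le_trans h); rewrite -/m -/l.
  have x1x : x1 <= 2 * x by lra.
  apply: (@le_trans _ _ (l / m * (l * tB x))).
    by rewrite ler_wpM2l ?hx1// divr_ge0//; [lra|exact: ltW].
  have -> : l / m * (l * tB x) = l * l / m * tB x by ring.
  by rewrite ler_pM2r// ler_pM2r ?invr_gt0.
exists e.
  apply/cvgrPdist_le => eps eps0.
  have [x0 hx0] := pW_le _ eps0.
  near=> x; rewrite sub0r normrN ger0_norm ?le_max ?lexx//.
  rewrite ge_max (ltW eps0)/= lerBlDr ler_pdivrMr//.
  have xx0 : x0 <= x by near: x; apply: nbhs_pinfty_ge; exact: num_real.
  have := hx0 x xx0; rewrite mulrAC ler_pdivlMr//; lra.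
near=> x; rewrite pWE real_tailE -EFinM lee_fin -/m -/(tB x).
have : pW x * m / tB x <= 1 + e x.
  by rewrite -lerBlDl /e le_max lexx orbT.
by rewrite ler_pdivrMr// mulrAC ler_pdivlMr.
Unshelve. all: by end_near.
Qed.
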